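(* Let $d,r$ be integers with $1\le d<q$ and $1\le r\le\binom{m+d}{m}$. Then there is an integer $e_0$ such that $A_r(d,m;e)=K_r(d,m)$ for all $e\ge e_0$. Consequently, $e_r(d,m)\le K_r(d,m)$.
   Context: Let $q$ be a prime power, $\mathbb{F}_q$ the finite field with $q$ elements, and $m$ a positive integer. For $j\in\mathbb{Z}$ put $\mathsf{p}_j=q^j+q^{j-1}+\dots+q+1$ if $j\ge 0$ and $\mathsf{p}_j=0$ if $j<0$. For homogeneous $F_1,\dots,F_r\in\mathbb{F}_q[x_0,\dots,x_m]$, $V(F_1,\dots,F_r)(\mathbb{F}_q)$ is the set of $\mathbb{F}_q$-rational points of $\mathbb{P}^m$ at which all $F_i$ vanish. $e_r(d,m)$ is the maximum of $|V(F_1,\dots,F_r)(\mathbb{F}_q)|$ over all families of $r$ linearly independent homogeneous polynomials of degree $d$ in $\mathbb{F}_q[x_0,\dots,x_m]$. A monomial $\mu\neq 1$ in $x_0,\dots,x_m$ can be written $\mu=x_0^{a_0}\cdots x_\ell^{a_\ell}$ with $0\le \ell\le m$ and $a_\ell>0$; it is called projectively reduced if $a_0,\dots,a_{\ell-1}\le q-1$; the monomial $1$ is also projectively reduced. Let $\overline{\mathbb{M}}_e$ be the set of projectively reduced monomials of degree $e$. For a set $\mathcal{S}$ of monomials, $\nabla_e(\mathcal{S})=\{\mu\in\overline{\mathbb{M}}_e:\nu\mid\mu \text{ for some }\nu\in\mathcal{S}\}$ and $\Delta_e(\mathcal{S})=\overline{\mathbb{M}}_e\setminus\nabla_e(\mathcal{S})$.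 For $1\le r\le|\overline{\mathbb{M}}_d|$, $A_r(d,m;e)=\max\{|\Delta_e(\mathcal{S})|:\mathcal{S}\subseteq\overline{\mathbb{M}}_d,\ |\mathcal{S}|=r\}$. Lexicographic order on monomials: $x_0^{b_0}\cdots x_m^{b_m}\prec x_0^{a_0}\cdots x_m^{a_m}$ iff at the first index $i$ where the exponents differ one has $a_i>b_i$ (so $x_0\succ x_1\succ\dots\succ x_m$). $K_r(d,m)=\sum_{j=0}^{m-1}a_j\mathsf{p}_{m-1-j}$, where $(a_0,\dots,a_m)$ is the $r$-th element, in descending lexicographic order, of the set of $(m+1)$-tuples of nonnegative integers with sum $d$ (equivalently, $x_0^{a_0}\cdots x_m^{a_m}$ is the $r$-th element of the degree-$d$ monomials listed in descending lexicographic order). *)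

(* Defs.v *)
From HB Require Import structures.
From mathcomp Require Import all_boot all_order all_algebra all_field.
From mathcomp Require Import mpoly.
Set Implicit Arguments. Unset Strict Implicit. Unset Printing Implicit Defensive.
Import GRing.Theory.

(* Monomials x_0^{a_0} ... x_m^{a_m} of degree <= e are encoded by their
   exponent vectors a : 'I_(m+1) -> 'I_(e+1) (so the type is finite). *)
Definition mono (m e : nat) := {ffun 'I_m.+1 -> 'I_e.+1}.

Definition mdegree m e (a : mono m e) : nat := \sum_(i < m.+1) (a i : nat).

(* projectively reduced: if l is the last index with a_l > 0, then
   a_0, ..., a_{l-1} <= q - 1 (the monomial 1 is reduced). *)
Definition proj_reduced (q : nat) m e (a : mono m e) : bool :=
  [forall l : 'I_m.+1, (0 < a l) && [forall j : 'I_m.+1, (l < j) ==> (a j == 0 :> nat)]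
     ==> [forall i : 'I_m.+1, (i < l) ==> (a i <= q.-1)]].

Definition Mbar (q m e : nat) : {set mono m e} :=
  [set a | (mdegree a == e) && proj_reduced q a].

Definition mdivides m d e (nu : mono m d) (mu : mono m e) : bool :=
  [forall i, (nu i : nat) <= mu i].

Definition nabla (q m d e : nat) (S : {set mono m d}) : {set mono m e} :=
  [set mu in Mbar q m e | [exists nu in S, mdivides nu mu]].

Definition Delta (q m d e : nat) (S : {set mono m d}) : {set mono m e} :=
  Mbar q m e :\: nabla q e S.

Definition A_r (q r d m e : nat) : nat :=
  \max_(S : {set mono m d} | (S \subset Mbar q m d) && (#|S| == r)) #|Delta q e S|.

Definition lexlt m d (b a : mono m d) : bool :=
  [exists i : 'I_m.+1, ((b i : nat) < a i) &&
      [forall j : 'I_m.+1, (j < i) ==> (b j == a j :> nat)]].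

Definition desc_lex_monos (m d : nat) : seq (mono m d) :=
  sort (fun a b => ~~ lexlt a b) [seq a <- enum (mono m d) | mdegree a == d].

Definition pp (q j : nat) : nat := \sum_(i < j.+1) q ^ i.

Definition K_r (q r d m : nat) : nat :=
  let a := nth [ffun=> ord0] (desc_lex_monos m d) r.-1 in
  \sum_(j < m) (a (widen_ord (leqnSn m) j) : nat) * pp q (m.-1 - j).

(* F_q-rational points of P^m, represented by the normalized vectors
   whose first nonzero coordinate equals 1. *)
Definition normalized (F : fieldType) m (v : 'I_m.+1 -> F) : bool :=
  [exists i : 'I_m.+1, (v i == 1%R) && [forall j : 'I_m.+1, (j < i) ==> (v j == 0%R)]].

Definition Vpts (F : finFieldType) m r (Fs : 'I_r -> {mpoly F[m.+1]})
  : {set {ffun 'I_m.+1 -> F}} :=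
  [set v : {ffun 'I_m.+1 -> F} | normalized v && [forall i, (Fs i).@[v] == 0%R]].

Definition lin_indep (F : fieldType) n r (Fs : 'I_r -> {mpoly F[n]}) : Prop :=
  forall c : 'I_r -> F, (\sum_(i < r) c i *: Fs i)%R = 0%R -> forall i, c i = 0%R.

(* Main.v *)
Require Import Defs.
From HB Require Import structures.
From mathcomp Require Import all_boot all_order all_algebra all_field.
From mathcomp Require Import mpoly zify.

Set Implicit Arguments. Unset Strict Implicit. Unset Printing Implicit Defensive.

(** Let [q = #|F|]. For large [e], the number of reduced monomials of degree [e]
    divisible by a member of a set [S] of monomials of degree [d < q] does not
    increase when [S] is compressed along a pair of adjacent variables, so [S]
    may be taken closed under the moves x_(i+1) -> x_i (Borel). A reduced
    monomial is then divisible by a member of [S] iff its lexicographically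
    greatest divisor of degree [d] lies in [S], so the count is a sum over [S]
    of weights that decrease with the last variable of the monomial and its
    exponent. A refinement of the Bigatti-Hulett comparison of Borel sets with
    lex segments shows that the lex segment minimises this sum, and for the lex
    segment with least element w the complementary count is K(w).

    For the bound on points, the leading monomials of the span of the F_i contain
    a set [S] of size [r]; modulo the F_i and the relations
    x_i^q x_j = x_i x_j^q on rational points, every monomial of degree [e] is a
    combination of those in Delta_e(S), while forms of degree [e] separate the
    points of the variety. *)

(** * Exponent vectors of fixed degree *)

Fixpoint vecs (n d : nat) : seq (seq nat) :=
  if n is n'.+1 then [seq c :: v | c <- iota 0 d.+1, v <- vecs n' (d - c)]
  else if d is 0 then [:: [::]] else [::].

Lemma mem_vecs n d u : (u \in vecs n d) = (size u == n) && (sumn u == d).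
Proof.
elim: n d u => [|n IHn] d u.
  by case: d u => [|d] [|a u].
apply/allpairsPdep/idP => [[c [v [Hc Hv ->]]]|].
  move: Hc Hv; rewrite mem_iota IHn /= => Hc /andP[/eqP-> /eqP->].
  by rewrite eqxx; lia.
case: u => [|c v] // Hu; have [Hs Hd] : size v = n /\ c + sumn v = d by move: Hu => /=; lia.
exists c, v; split=> //.
  by rewrite mem_iota; lia.
by rewrite IHn; lia.
Qed.

Lemma vecs_uniq n d : uniq (vecs n d).
Proof.
elim: n d => [|n IHn] d; first by case: d.
apply: allpairs_uniq_dep; first exact: iota_uniq.
  by move=> c _; apply: IHn.
by move=> [c v] [c' v'] _ _ /= [-> ->].
Qed.

Lemma sum_vecsS n d (G : seq nat -> nat) :
  \sum_(u <- vecs n.+1 d) G u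
  = \sum_(c < d.+1) \sum_(v <- vecs n (d - c)) G ((c : nat) :: v).
Proof.
rewrite big_allpairs_dep.
rewrite -(big_mkord xpredT (fun c => \sum_(v <- vecs n (d - c)) G (c :: v))).
by rewrite /index_iota subn0.
Qed.

Lemma sum_vecs_rev n d (G : seq nat -> nat) :
  \sum_(u <- vecs n d) G u = \sum_(u <- vecs n d) G (rev u).
Proof.
rewrite -(big_map rev xpredT G); apply: perm_big.
apply: uniq_perm; rewrite ?vecs_uniq ?(map_inj_uniq (can_inj revK)) ?vecs_uniq //.
move=> u; apply/idP/mapP => [Hu|[v Hv ->]].
  exists (rev u); rewrite ?revK // mem_vecs size_rev sumn_rev.
  by rewrite mem_vecs in Hu.
by rewrite mem_vecs size_rev sumn_rev -mem_vecs.
Qed.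

Lemma size_vecs n d : size (vecs n.+1 d) = 'C(n + d, n).
Proof.
have sz N D : size (vecs N D) = \sum_(u <- vecs N D) 1 by rewrite sum1_size.
elim: n d => [|n IHn] d.
  rewrite sz sum_vecsS big_ord_recr big1 => [|c _] /=; last first.
    by have := ltn_ord c; rewrite -subn_gt0; case: (d - c) => // k _; rewrite big_nil.
  by rewrite subnn big_seq1 add0n bin0.
elim: d => [|d IHd].
  rewrite sz sum_vecsS big_ord1 -sz IHn !addn0 !binn //.
rewrite sz sum_vecsS big_ord_recl subn0 -sz IHn.
under eq_bigr => i _ do rewrite lift0 subSS.
rewrite -(sum_vecsS n.+1 d (fun=> 1)) -sz IHd.
by rewrite addSn addnS addSn binS addnC; congr (_ + _); rewrite addnS.
Qed.

Definition divl (nu mu : seq nat) := all2 leq nu mu.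

Lemma sum_indicator_has (T : eqType) (s : seq T) (P Q : pred T) :
  \sum_(u <- s) P u < \sum_(u <- s) Q u -> exists2 u, u \in s & Q u && ~~ P u.
Proof.
move=> H; apply/hasP; apply: contraTT H => /hasPn H.
rewrite -leqNgt big_seq [X in _ <= X]big_seq; apply: leq_sum => u /H.
by case: (P u) (Q u) => [] [].
Qed.

(** * Lexicographic segments and Borel sets *)

Definition strict_total (T : eqType) (lt : rel T) :=
  [/\ irreflexive lt, transitive lt & forall u v, u != v -> lt u v || lt v u].

Section InitialSegments.
Variables (T : eqType) (lt : rel T).
Hypothesis lt_order : strict_total lt.

(** The relation [~~ lt a b] is the order [a >= b], so sorting by it lists elements in descending
    order. *)
Lemma ge_order : [/\ total (fun a b => ~~ lt a b), transitive (fun a b => ~~ lt a b) &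
  antisymmetric (fun a b => ~~ lt a b)].
Proof.
case: lt_order => irr tr tot; split.
- move=> a b; rewrite -negb_and; apply/negP=> /andP[ab ba].
  by have := tr _ _ _ ab ba; rewrite irr.
- move=> b a c ab bc; apply/negP=> ac.
  case: (eqVneq a b) => [E|/tot/orP[|ba]]; [|by apply/negP|].
    by rewrite E in ac; rewrite ac in bc.
  by rewrite (tr _ _ _ ba ac) in bc.
- move=> a b /andP[ab ba]; apply/eqP; apply: contraT => /tot.
  by rewrite (negbTE ab) (negbTE ba).
Qed.

Lemma mem_take_sort (x0 : T) (s : seq T) r v :
  let l := sort (fun a b => ~~ lt a b) s in
  uniq s -> 0 < r <= size s -> v \in s ->
  (v \in take r l) = ~~ lt v (nth x0 l r.-1).
Proof.
case: lt_order => irr tr tot l us /andP[r0 rs] vs.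
have [geT getr _] := ge_order.
have sl : sorted (fun a b => ~~ lt a b) l by apply: sort_sorted.
have ul : uniq l by rewrite sort_uniq.
have zl : size l = size s by rewrite size_sort.
have vl : v \in l by rewrite mem_sort.
have ge_refl : reflexive (fun a b => ~~ lt a b) by move=> a; rewrite irr.
have ltr : r.-1 < size l by lia.
have lti : index v l < size l by rewrite index_mem.
rewrite in_take //; case: ltnP => Hi; apply/esym.
  rewrite -{1}(nth_index x0 vl).
  by apply: (sorted_leq_nth getr ge_refl) => //; rewrite ?inE; lia.
apply/negbTE; rewrite negbK.
have Hle : ~~ lt (nth x0 l r.-1) (nth x0 l (index v l)).
  by apply: (sorted_leq_nth getr ge_refl) => //; rewrite ?inE; lia.
rewrite nth_index // in Hle.
have : v != nth x0 l r.-1.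
  apply/eqP => E; move: Hi; rewrite [in index _ _]E index_uniq //; lia.
by case/tot/orP => // H; rewrite H in Hle.
Qed.

Lemma sum_mem_take (s l : seq T) r :
  uniq s -> perm_eq l s -> r <= size s -> \sum_(u <- s) (u \in take r l) = r.
Proof.
move=> us pls rs; have ul : uniq l by rewrite (perm_uniq pls).
rewrite -(perm_big _ pls) /= -{1}(cat_take_drop r l) big_cat /= big_seq.
rewrite (eq_bigr (fun=> 1)) => [|u ->] //; rewrite -big_seq sum1_size.
rewrite big_seq big1 => [|u Hu].
  by rewrite addn0 size_take (perm_size pls); case: ltngtP rs => // ->.
move: ul; rewrite -{1}(cat_take_drop r l) cat_uniq => /and3P[_ /hasPn H _].
by have /negbTE-> := H u Hu.
Qed.

Lemma segment_exists (s : seq T) r : uniq s -> r <= size s ->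
  exists L : pred T, \sum_(u <- s) L u = r /\
    {in s &, forall u v, L u -> lt u v -> L v}.
Proof.
move=> us rs; case: (posnP r) => [->|r0].
  by exists pred0; split=> //; rewrite big1.
case: s us rs => [|x0 s']; first by case: r r0.
set s := x0 :: s' => us rs.
exists (mem (take r (sort (fun a b => ~~ lt a b) s))); split.
  by apply: sum_mem_take => //; rewrite perm_sort.
move=> u v us' vs; rewrite /= !(@mem_take_sort x0) ?r0 // => uw uv.
case: lt_order => irr tr tot; apply: contra uw; exact: tr.
Qed.

(** If u were in A but not in B, every element of B would lie above u and hence in A, so B would be
    strictly smaller than A. *)
Lemma segment_nested (s : seq T) (A B : pred T) :
  {in s &, forall u v, A u -> lt u v -> A v} ->
  {in s &, forall u v, B u -> lt u v -> B v} ->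
  \sum_(u <- s) A u <= \sum_(u <- s) B u -> {in s, forall u, A u -> B u}.
Proof.
case: lt_order => irr tr tot sA sB le_AB u us Au; apply/negPn/negP => nBu.
have BA v : v \in s -> B v <= A v.
  move=> vs; case Bv: (B v) => //.
  have : v != u by apply: contra nBu => /eqP <-.
  case/tot/orP => [vu|uv]; first by rewrite (sB _ _ vs us Bv vu) in nBu.
  by rewrite (sA _ _ us vs Au uv).
move: le_AB; rewrite leqNgt => /negP; apply.
rewrite (big_rem u us) [X in _ < X](big_rem u us) /= Au (negbTE nBu).
rewrite add0n ltnS big_seq [X in _ <= X]big_seq.
by apply: leq_sum => v /mem_rem; apply: BA.
Qed.

End InitialSegments.

(** * The lexicographic order, read forwards and backwards *)

Fixpoint lexl (u v : seq nat) : bool :=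
  match u, v with
  | a :: u', b :: v' => (a < b) || (a == b) && lexl u' v'
  | [::], _ :: _ => true
  | _, [::] => false
  end.

(* [lexl] read from the last entry: the head is the least significant. *)
Fixpoint rlexl (u v : seq nat) : bool :=
  match u, v with
  | a :: u', b :: v' => rlexl u' v' || (u' == v') && (a < b)
  | [::], _ :: _ => true
  | _, [::] => false
  end.

Lemma lexl_order : strict_total lexl.
Proof.
split.
- by elim=> [|a u IH] //=; rewrite ltnn eqxx.
- elim=> [|b v IH] [|a u] [|c w] //=.
  case/orP=> [ab|/andP[/eqP-> uv]] /orP[bc|/andP[/eqP<- vw]];
    rewrite ?(ltn_trans ab bc) ?ab ?bc //.
  by rewrite eqxx (IH _ _ uv vw) orbT.
- elim=> [|a u IH] [|b v] //=; rewrite eqseq_cons negb_and eq_sym.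
  by case: ltngtP => //= _; apply: IH.
Qed.

Lemma rlexl_order : strict_total rlexl.
Proof.
split.
- by elim=> [|a u IH] //=; rewrite ltnn andbF IH.
- elim=> [|b v IH] [|a u] [|c w] //=.
  case/orP=> [ab|/andP[/eqP-> uv]] /orP[bc|/andP[/eqP<- vw]].
  + by rewrite (IH _ _ ab bc).
  + by rewrite ab.
  + by rewrite bc.
  + by rewrite eqxx (ltn_trans uv vw) orbT.
- elim=> [|a u IH] [|b v] //=; rewrite eqseq_cons negb_and [v == u]eq_sym.
  case: (eqVneq u v) => /= [->|/IH/orP[]->]; rewrite ?orbF ?orbT //.
  by case: ltngtP; rewrite ?orbT.
Qed.

Lemma lexl_rcons a b u v : size u = size v ->
  lexl (rcons u a) (rcons v b) = lexl u v || (u == v) && (a < b).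
Proof.
elim: u v => [|c u IH] [|c' v] //= => [_|[/IH->]]; first by rewrite andbF orbF.
by rewrite eqseq_cons; case: ltngtP.
Qed.

Lemma lexl_rev u v : size u = size v -> lexl (rev u) (rev v) = rlexl u v.
Proof.
elim: u v => [|a u IH] [|b v] //= [E].
by rewrite !rev_cons lexl_rcons ?size_rev // IH // (can_eq revK).
Qed.

(** With variables listed from last to first, this divides by the last variable that occurs. For a
    Borel set S of degree d, [S \o dec] is the set of its multiples in degree d + 1, called its
    growth below. *)
Fixpoint dec (u : seq nat) : seq nat :=
  match u with
  | 0 :: v => 0 :: dec v
  | c.+1 :: v => c :: v
  | [::] => [::]
  end.

Lemma size_dec u : size (dec u) = size u.
Proof. by elim: u => [|[|c] u IH] //=; rewrite IH. Qed.

Lemma sumn_dec u : sumn (dec u) = (sumn u).-1.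
Proof. by elim: u => [|[|c] u IH] //=. Qed.

Lemma dec_vecs n d u : u \in vecs n d.+1 -> dec u \in vecs n d.
Proof. by rewrite !mem_vecs size_dec sumn_dec => /andP[-> /eqP->] /=. Qed.

(** A positive head is lowered, which is a bijection onto degree d; a zero head passes [dec] on to
    the tail. So the growth of a set is its size plus the growth of its slice at 0. *)
Lemma sum_dec n d (G : seq nat -> nat) :
  \sum_(u <- vecs n.+1 d.+1) G (dec u)
  = \sum_(v <- vecs n d.+1) G (0 :: dec v) + \sum_(u <- vecs n.+1 d) G u.
Proof.
by rewrite !sum_vecsS big_ord_recl subn0; congr (_ + _).
Qed.

Lemma rlexl_dec u : 0 < sumn u -> rlexl (dec u) u.
Proof.
elim: u => [|[|c] u IH] //=; first by move/IH->.
by rewrite eqxx ltnS leqnn orbT.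
Qed.

(** The mixed case in the monotonicity of [dec]: on one side only the head is lowered, on the other
    [dec] acts on a tail of larger degree. *)
Lemma rlexl_dec_r u v : size u = size v -> sumn u < sumn v -> rlexl u v ->
  (dec v == u) || rlexl u (dec v).
Proof.
elim: u v => [|a u IH] [|[|b] v] //= [E].
  rewrite andbF orbF => Hs uv.
  have /orP[/eqP D|->] : (dec v == u) || rlexl u (dec v) by apply: IH => //; lia.
    by have := sumn_dec v; rewrite D eqseq_cons eqxx andbT; lia.
  by rewrite orbT.
move=> _ /orP[->|/andP[/eqP-> ab]]; rewrite ?orbT // eqseq_cons eqxx /= andbT.
by case: ltngtP ab; rewrite ?orbT //; lia.
Qed.

Lemma rlexl_dec2 u v : size u = size v -> sumn u = sumn v -> rlexl u v ->
  (dec u == dec v) || rlexl (dec u) (dec v).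
Proof.
elim: u v => [|a u IH] [|b v] //= [E] Hs.
case/orP=> [uv|/andP[/eqP Euv]]; last by rewrite Euv in Hs; lia.
case: a b Hs => [|a] [|b] Hs /=.
- have /orP[/eqP->|->] : (dec u == dec v) || rlexl (dec u) (dec v).
    by apply: IH => //; lia.
  + by rewrite eqxx.
  + by rewrite orbT.
- have du : rlexl (dec u) v.
    by case: rlexl_order => _ tr _; apply: tr uv; apply: rlexl_dec; lia.
  by rewrite du orbT.
- have /orP[/eqP D|->] : (dec v == u) || rlexl u (dec v).
    by apply: rlexl_dec_r => //; lia.
    by have := sumn_dec v; rewrite D eqseq_cons eqxx andbT; lia.
  by rewrite orbT.
- by rewrite uv orbT.
Qed.

(** Mirror image of [borel] below: lists run from the last variable to the first, so moves push
    exponents towards the end. *)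
Definition rborel (S : pred (seq nat)) :=
  forall p a b s, S (p ++ a.+1 :: b :: s) -> S (p ++ a :: b.+1 :: s).

Lemma rborel_cons S c : rborel S -> rborel (fun v => S (c :: v)).
Proof. by move=> bS p a b s; apply: (bS (c :: p)). Qed.

(** One unit travels from the head, through the zeros, to the first positive entry of u by a chain
    of adjacent moves. *)
Lemma rborel_dec S c u : rborel S -> 0 < sumn u -> S (c.+1 :: dec u) -> S (c :: u).
Proof.
elim: u S c => [|[|b] u IH] S c bS //= Hu SH; last exact: (bS [::]).
have := bS [::] c 0 (dec u) SH => /= H.
by apply: (IH (fun v => S (c :: v)) 0) => //; apply: rborel_cons.
Qed.

Definition rlex_segment n d (L : pred (seq nat)) :=
  {in vecs n d &, forall u v, L u -> rlexl u v -> L v}.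

(** * Slices of Borel sets and of lex segments *)

Notation card_vecs n d S := (\sum_(u <- vecs n d) (S u : nat)).

Definition slice (S : pred (seq nat)) c : pred (seq nat) := fun v => S (c :: v).

Lemma card_slices n d (S : pred (seq nat)) :
  card_vecs n.+1 d S = \sum_(c < d.+1) card_vecs n (d - c) (slice S c).
Proof. exact: sum_vecsS. Qed.

Lemma segment_slice n d L c : c <= d ->
  rlex_segment n.+1 d L -> rlex_segment n (d - c) (slice L c).
Proof.
move=> cd sL u v; rewrite !mem_vecs => /andP[/eqP su /eqP du] /andP[/eqP sv /eqP dv].
rewrite /slice => Lu uv; apply: sL Lu _; rewrite ?mem_vecs /= ?uv //.
  by rewrite su du subnKC // !eqxx.
by rewrite sv dv subnKC // !eqxx.
Qed.

Lemma segment_dec n d L : rlex_segment n d L -> rlex_segment n d.+1 (L \o dec).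
Proof.
move=> sL u v uv vv /= Lu lt_uv.
have [Eu Ev] := (dec_vecs uv, dec_vecs vv).
move: uv vv; rewrite !mem_vecs => /andP[/eqP su /eqP du] /andP[/eqP sv /eqP dv].
have /orP[/eqP<- //|] := rlexl_dec2 (etrans su (esym sv)) (etrans du (esym dv)) lt_uv.
exact: sL.
Qed.

(** Slice sizes by the exponent c of the last variable cross at most once. This is a predicate of n
    because it is proved by strong induction, through lemmas that assume the smaller cases. *)
Definition crossing n := forall d S L, rborel S -> rlex_segment n.+1 d L ->
  exists s,
    (forall c, c <= d -> c < s ->
       card_vecs n (d - c) (slice L c) <= card_vecs n (d - c) (slice S c)) /\
    (forall c, c <= d -> s <= c ->
       card_vecs n (d - c) (slice S c) <= card_vecs n (d - c) (slice L c)).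

(** If the crossing is at 0, the slices c > 0 of S total at most those of L, so [le_LS] leaves only
    the claimed inequality for slice 0. *)
Lemma crossing_slice0 n d S L : crossing n -> rborel S -> rlex_segment n.+1 d L ->
  card_vecs n.+1 d L <= card_vecs n.+1 d S -> card_vecs n d (slice L 0) <= card_vecs n d (slice S 0).
Proof.
move=> cr bS sL; have [s [lt_s ge_s]] := cr _ _ _ bS sL.
case: (posnP s) => [s0|s_gt0] le_LS; last by have := lt_s 0 isT s_gt0; rewrite subn0.
move: le_LS; rewrite !card_slices !big_ord_recl subn0.
have : \sum_(i < d) card_vecs n (d - lift ord0 i) (slice S (lift ord0 i)) <=
   \sum_(i < d) card_vecs n (d - lift ord0 i) (slice L (lift ord0 i)).
  by apply: leq_sum => i _; apply: ge_s; rewrite ?s0 ?lift0.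
by move=> /=; lia.
Qed.

(** Macaulay's growth bound for Borel sets. Growth is size plus growth of slice 0, and
    [crossing_slice0] carries the size comparison to slice 0. *)
Lemma card_dec_mono n d S L : (forall k, k < n -> crossing k) ->
  rborel S -> rlex_segment n d L -> card_vecs n d L <= card_vecs n d S ->
  card_vecs n d.+1 (L \o dec) <= card_vecs n d.+1 (S \o dec).
Proof.
elim: n S L => [|n IHn] S L cr bS sL le_LS; first by rewrite !big_nil.
rewrite /= (sum_dec n d L) (sum_dec n d S) leq_add //.
have := @IHn (slice S 0) (slice L 0); apply.
- by move=> k kn; apply: cr; apply: ltnW.
- exact: rborel_cons.
- by have := @segment_slice n d L 0 isT sL; rewrite subn0.
- exact: (crossing_slice0 (cr n _) bS sL).
Qed.

(** The preimage of L under [dec] is a lex segment no larger than L', hence contained in it, and it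
    contains [c.+1 :: v]. *)
Lemma lex_growth n d (S S' L L' : pred (seq nat)) c v : (forall k, k < n -> crossing k) ->
  rborel S -> {in vecs n d.+1, forall u, S (dec u) -> S' u} ->
  rlex_segment n d L -> rlex_segment n d.+1 L' ->
  card_vecs n d L = card_vecs n d S -> card_vecs n d.+1 L' = card_vecs n d.+1 S' ->
  c :: v \in vecs n d -> L (c :: v) -> L' (c.+1 :: v).
Proof.
move=> cr bS SS' sL sL' eqL eqL' cv Lcv.
apply: (segment_nested rlexl_order (segment_dec sL) sL') => //.
  rewrite eqL'; apply: leq_trans (card_dec_mono cr bS sL _) _; first by rewrite eqL.
  rewrite big_seq [X in _ <= X]big_seq; apply: leq_sum => u /SS' /=.
  by case: (S _) => // ->.
by move: cv; rewrite !mem_vecs.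
Qed.

(* Each slice of S is replaced by the lex segment T_c of the same size; by growth
   of lex segments the T_c are still linked by x_(n-1) T_(c+1) <= T_c. At the first
   s with |T_s| < |L_s|, any w in L_s but not in T_s is lexicographically below
   all of T_c, c > s, which forces T_c into L_c. *)
Lemma crossing_all n : crossing n.
Proof.
elim/ltn_ind: n => n cr d S L bS sL.
have Tex c : exists T : pred (seq nat), card_vecs n (d - c) T = card_vecs n (d - c) (slice S c) /\
    rlex_segment n (d - c) T.
  apply: (segment_exists rlexl_order); first exact: vecs_uniq.
  by rewrite -sum1_size; apply: leq_sum => u _; apply: leq_b1.
have Tgrow (T T' : pred (seq nat)) j b v : j < d ->
    card_vecs n (d - j.+1) T = card_vecs n (d - j.+1) (slice S j.+1) ->
    rlex_segment n (d - j.+1) T ->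
    card_vecs n (d - j) T' = card_vecs n (d - j) (slice S j) -> rlex_segment n (d - j) T' ->
    b :: v \in vecs n (d - j.+1) -> T (b :: v) -> T' (b.+1 :: v).
  move=> jd; have -> : d - j = (d - j.+1).+1 by lia.
  move=> eqT sT eqT' sT'; apply: (@lex_growth n (d - j.+1) (slice S j.+1) (slice S j)) => //.
    exact: rborel_cons.
  move=> u; rewrite mem_vecs => /andP[_ /eqP Hu]; apply: rborel_dec => //.
  by rewrite Hu.
pose bad s := (s <= d) && (card_vecs n (d - s) (slice S s) < card_vecs n (d - s) (slice L s)).
case: (boolP (has bad (iota 0 d.+1))) => [/hasP[s0 _ bad0]|/hasPn good]; last first.
  exists d.+1; split=> c cd cs; last by lia.
  have := good c; rewrite mem_iota /bad cd /= -leqNgt; apply; lia.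
have ex_bad : exists s, bad s by exists s0.
exists (ex_minn ex_bad); case: ex_minnP => s /andP[sd bad_s] min_s; split=> c cd cs.
  by rewrite leqNgt; apply: contraL cs => H; rewrite -leqNgt min_s // /bad cd.
move: cs; rewrite leq_eqVlt => /orP[/eqP<-|sc]; first exact: ltnW.
have [T [eqT sT]] := Tex s; have [U [eqU sU]] := Tex c.
rewrite -eqU big_seq [X in _ <= X]big_seq; apply: leq_sum => u u_vec.
case Uu: (U u) => //; suff -> : slice L c u by [].
have [w w_vec /andP[Lw nTw]] : exists2 w, w \in vecs n (d - s) & slice L s w && ~~ T w.
  by apply: sum_indicator_has; rewrite eqT.
have [su du] : size u = n /\ sumn u = d - c.
  by move: u_vec; rewrite mem_vecs => /andP[/eqP-> /eqP->].
have [sw dw] : size w = n /\ sumn w = d - s.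
  by move: w_vec; rewrite mem_vecs => /andP[/eqP-> /eqP->].
case: u w su sw Uu u_vec du Lw nTw w_vec dw => [|b v] [|b' v'] /= su sw;
  [by lia | by move: su; rewrite -sw | by move: sw; rewrite -su |].
move=> Uu u_vec du Lw nTw w_vec dw.
(* Raising the head k times leads from T_c to T_(c-k); k = c - s will give T_s. *)
have lift k : k <= c - s -> forall Tk : pred (seq nat), card_vecs n (d - (c - k)) Tk =
      card_vecs n (d - (c - k)) (slice S (c - k)) ->
    rlex_segment n (d - (c - k)) Tk -> Tk (b + k :: v).
  elim: k => [_ Tk|k IHk kc Tk eqk sk].
    rewrite subn0 addn0 => eqk sk.
    by apply: (segment_nested rlexl_order sU sk) => //; rewrite eqk -eqU.
  have [Tk' [eqk' sk']] := Tex (c - k).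
  rewrite addnS; apply: (Tgrow Tk' Tk (c - k.+1)) => //; try lia.
  - by have -> : (c - k.+1).+1 = c - k by lia.
  - by have -> : (c - k.+1).+1 = c - k by lia.
  - by rewrite mem_vecs /= su eqxx; lia.
  - by apply: IHk => //; lia.
have Tx : T (b + (c - s) :: v).
  by apply: lift => //; have -> : c - (c - s) = s by lia.
have x_vec : b + (c - s) :: v \in vecs n (d - s).
  by rewrite mem_vecs /= su eqxx; lia.
have : b + (c - s) :: v != b' :: v' by apply: contra nTw => /eqP <-.
case: rlexl_order => _ _ tot /tot/orP[xw|].
  by rewrite (sT _ _ x_vec w_vec Tx xw) in nTw.
(* Equal tails would force equal heads, both vectors having degree d - s. So the tails differ, and
   they alone put [s :: b' :: v'] below [c :: b :: v]. *)
rewrite /= => /orP[v'v|/andP[/eqP E]]; last by rewrite E in dw; lia.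
apply: (sL (s :: b' :: v')) => //; rewrite ?mem_vecs /= ?su ?sw ?v'v ?eqxx //; lia.
Qed.

(** Chebyshev's argument, written without subtraction: if W is the weight at the crossing, then (s c
    - l c) (w c - W) >= 0 for each c. Sum over c and use W >= B. *)
Lemma crossing_weighted_sum d t B (s l w : nat -> nat) :
  (forall c, c <= d -> c < t -> l c <= s c) ->
  (forall c, c <= d -> t <= c -> s c <= l c) ->
  (forall c c', c <= c' <= d -> B <= w c' <= w c) ->
  \sum_(c < d.+1) l c <= \sum_(c < d.+1) s c ->
  \sum_(c < d.+1) l c * w c + (\sum_(c < d.+1) s c) * B <=
  \sum_(c < d.+1) s c * w c + (\sum_(c < d.+1) l c) * B.
Proof.
move=> lt_t ge_t wB le_ls.
have [W [BW HW]] : exists W, B <= W /\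
    forall c, c <= d -> l c * w c + s c * W <= s c * w c + l c * W.
  case: (leqP t d) => td.
    exists (w t); split=> [|c cd]; first by have := wB t t; rewrite leqnn td; lia.
    case: (ltnP c t) => ct.
      by have := lt_t c cd ct; have := wB c t; rewrite (ltnW ct) td; nia.
    by have := ge_t c cd ct; have := wB t c; rewrite ct cd; nia.
  exists B; split=> // c cd; have := lt_t c cd; have := wB c c.
  by rewrite cd leqnn; nia.
have : \sum_(c < d.+1) (l c * w c + s c * W) <= \sum_(c < d.+1) (s c * w c + l c * W).
  by apply: leq_sum => c _; apply: HW; rewrite -ltnS.
rewrite !big_split -!big_distrl /=; move: le_ls.
move: (\sum_(c < d.+1) l c) (\sum_(c < d.+1) s c) => x y.
by move: (\sum_(c < d.+1) l c * w c) (\sum_(c < d.+1) s c * w c) => x' y'; nia.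
Qed.

(* [pts q n] is the number p_(n-1) of rational points of P^(n-1). *)
Fixpoint pts (q n : nat) : nat := if n is n'.+1 then q * pts q n' + 1 else 0.

(* Number of reduced monomials of large degree in n + z variables whose
   truncation to degree [sumn u] is [u] followed by z zeros. *)
Fixpoint rweight (q z : nat) (u : seq nat) : nat :=
  match u with
  | [::] => 0
  | 0 :: v => rweight q z.+1 v
  | t.+1 :: _ => (q - t.+1) * pts q z + 1
  end.

(** Each surplus element of S adds at least [(pts q z).+1], a lower bound for all weights. The
    surplus terms make the induction work, since slices at 0 may differ in size even when S and L do
    not. *)
Lemma rweight_mono q n d z (S L : pred (seq nat)) : 0 < d < q ->
  rborel S -> rlex_segment n d L -> card_vecs n d L <= card_vecs n d S ->
  \sum_(u <- vecs n d) L u * rweight q z u + card_vecs n d S * (pts q z).+1 <=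
  \sum_(u <- vecs n d) S u * rweight q z u + card_vecs n d L * (pts q z).+1.
Proof.
move=> dq; elim: n z S L => [|n IHn] z S L bS sL le_LS.
  by case: d dq {sL le_LS} => // d _ /=; rewrite !big_nil.
have [t [lt_t ge_t]] := crossing_all bS sL.
have le0 := crossing_slice0 (@crossing_all n) bS sL le_LS.
have sL0 : rlex_segment n d (slice L 0).
  by have := @segment_slice n d L 0 isT sL; rewrite subn0.
have {IHn sL0} := IHn z.+1 _ _ (@rborel_cons S 0 bS) sL0 le0.
(* Slices c > 0 have constant weight. Slice 0 has not; there [w 0] is the rate per surplus element
   from the induction hypothesis. *)
pose w c := if c is 0 then (pts q z.+1).+1 else (q - c) * pts q z + 1.
have split_sum (X : pred (seq nat)) : \sum_(u <- vecs n.+1 d) X u * rweight q z u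
    + card_vecs n d (slice X 0) * w 0
  = \sum_(u <- vecs n d) slice X 0 u * rweight q z.+1 u
    + \sum_(c < d.+1) card_vecs n (d - c) (slice X c) * w c.
  rewrite sum_vecsS !big_ord_recl !subn0 /= -!addnA; congr (_ + _).
  rewrite addnC; congr (_ + _); apply: eq_bigr => c _.
  by rewrite -[bump 0 c]/c.+1 /= -big_distrl.
have wP c c' : c <= c' <= d -> (pts q z).+1 <= w c' <= w c.
  by case: c c' => [|c] [|c'] //= H; apply/andP; split; nia.
have := crossing_weighted_sum lt_t ge_t wP; rewrite -!card_slices => /(_ le_LS).
have := split_sum S; have := split_sum L; rewrite /slice /=.
move: (\sum_(c < d.+1) _ * w c) (\sum_(c < d.+1) _ * w c) => x1 x2.
lia.
Qed.

(** * Weights *)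

Fixpoint reduced (q : nat) (u : seq nat) : bool :=
  if u is a :: v then ((a < q) || (sumn v == 0)) && reduced q v else true.

(* The divisor of degree d of the monomial u that is greatest for lexl. *)
Fixpoint trunc (d : nat) (u : seq nat) : seq nat :=
  if u is a :: v then minn a d :: trunc (d - a) v else [::].

(** For u of degree d < q, the number of reduced monomials of large degree with truncation u. If b
    is the last positive exponent and n variables follow, it is raised to one of b, ..., q - 1, with
    [pts q n] choices for the rest, or it absorbs all remaining degree. *)
Fixpoint weight (q : nat) (u : seq nat) : nat :=
  if u is b :: v then
    if sumn v == 0 then (q - b) * pts q (size v) + 1 else weight q v
  else 0.

Fixpoint lexval (q : nat) (u : seq nat) : nat :=
  if u is b :: v then b * pts q (size v) + lexval q v else 0.

Lemma sum_vecs1 d (G : seq nat -> nat) : \sum_(u <- vecs 1 d) G u = G [:: d].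
Proof.
rewrite sum_vecsS big_ord_recr big1 => [|c _] /=; last first.
  by have := ltn_ord c; rewrite -subn_gt0; case: (d - c) => // k _; rewrite big_nil.
by rewrite subnn big_seq1 add0n.
Qed.

Lemma vecs0 n : vecs n 0 = [:: nseq n 0].
Proof. by elim: n => //= n ->. Qed.

Arguments vecs : simpl never.

Lemma sumn_vec n d u : u \in vecs n d -> sumn u = d.
Proof. by rewrite mem_vecs => /andP[_ /eqP]. Qed.

Lemma size_vec n d u : u \in vecs n d -> size u = n.
Proof. by rewrite mem_vecs => /andP[/eqP]. Qed.

Lemma size_trunc d u : size (trunc d u) = size u.
Proof. by elim: u d => //= a u IH d; rewrite IH. Qed.

Lemma sumn_trunc d u : sumn (trunc d u) = minn (sumn u) d.
Proof. by elim: u d => /= [|a u IH] d; rewrite ?IH; lia. Qed.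

Lemma trunc0 u : trunc 0 u = nseq (size u) 0.
Proof. by elim: u => //= a u ->; rewrite minn0. Qed.

Lemma divl_trunc d u : divl (trunc d u) u.
Proof. by rewrite /divl; elim: u d => //= a u IH d; rewrite geq_minl IH. Qed.

Lemma sumn_nseq0 n : sumn (nseq n 0) = 0.
Proof. by elim: n. Qed.

Lemma weight_nseq0 q n : weight q (nseq n.+1 0) = pts q n.+1.
Proof. by rewrite /= sumn_nseq0 size_nseq subn0. Qed.

(** Split by the exponent a of the first variable. For a < d the rest is truncated to degree d - a;
    for d <= a < q the truncation is d followed by zeros and the rest is free; for a >= q
    reducedness forces a = e. *)
Lemma sum_reduced_trunc q n d e (G : seq nat -> nat) : d < q -> d + n * q <= e ->
  \sum_(u <- vecs n.+1 e) reduced q u * G (trunc d u)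
  = \sum_(u <- vecs n.+1 d) weight q u * G u.
Proof.
elim: n d e G => [|n IHn] d e G dq de.
  rewrite !sum_vecs1 /= orbT muln0 !mul1n; congr (G [:: _]); lia.
rewrite !sum_vecsS.
pose h a := \sum_(v <- vecs n.+1 (e - a)) reduced q (a :: v) * G (trunc d (a :: v)).
pose G0 := G (d :: nseq n.+1 0).
rewrite -(big_mkord xpredT h) (@big_cat_nat _ _ _ d) //=; last by lia.
rewrite (@big_cat_nat _ _ _ q d) //=; [|lia|nia].
rewrite big_nat_recr /=; last by nia.
have h_mid a : d <= a < q -> h a = pts q n.+1 * G0.
  move=> /andP[da aq].
  transitivity (\sum_(v <- vecs n.+1 (e - a)) reduced q v * (fun w => G (d :: w)) (trunc 0 v)).
    rewrite /h; apply: eq_bigr => v _ /=; rewrite aq /=.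
    by rewrite (minn_idPr da) (eqP (da : d - a == 0)).
  (* Truncation to degree 0 forgets everything, so this instance counts all reduced monomials in the
     remaining variables. *)
  by rewrite (IHn 0 (e - a) (fun w => G (d :: w))); [rewrite vecs0 big_seq1 weight_nseq0|lia|nia].
have h_high a : q <= a < e -> h a = 0.
  move=> /andP[qa ae]; rewrite /h big_seq big1 // => v /sumn_vec Hv /=.
  by rewrite ltnNge qa Hv subn_eq0 leqNgt ae.
have h_e : h e = G0.
  rewrite /h subnn vecs0 big_seq1.
  have red0 k : reduced q (nseq k 0) by elim: k => //= k ->; rewrite sumn_nseq0 orbT.
  have -> : reduced q (e :: nseq n.+1 0).
    by rewrite /reduced -/reduced red0 sumn_nseq0 orbT.
  have led : d <= e by lia.
  rewrite mul1n /trunc -/trunc (minn_idPr led) (eqP (led : d - e == 0)).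
  by rewrite trunc0 size_nseq.
rewrite (eq_big_nat _ _ h_mid) (eq_big_nat _ _ h_high) h_e.
rewrite sum_nat_const_nat big1_eq add0n.
rewrite big_ord_recr /= subnn vecs0 big_seq1 /= !sumn_nseq0 /= size_nseq.
rewrite big_mkord; congr (_ + _); last by rewrite /G0 /=; lia.
apply: eq_bigr => b _; have bd := ltn_ord b.
transitivity (\sum_(v <- vecs n.+1 (e - b)) reduced q v * (fun w => G ((b : nat) :: w)) (trunc (d - b) v)).
  apply: eq_bigr => v _ /=; have -> : b < q by lia.
  by rewrite (minn_idPl (ltnW bd)).
rewrite (IHn (d - b) (e - b) (fun w => G ((b : nat) :: w))); [|lia|nia].
rewrite big_seq [RHS]big_seq; apply: eq_bigr => v /sumn_vec Hv /=.
by have -> : (sumn v == 0) = false by rewrite Hv; have := ltn_ord b; lia.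
Qed.

Lemma sum_weight q n d : d < q -> \sum_(u <- vecs n.+1 d) weight q u = pts q n.+1.
Proof.
elim: n d => [|n IHn] d dq; first by rewrite sum_vecs1 /= !muln0.
rewrite sum_vecsS big_ord_recr /= subnn vecs0 big_seq1 /= !sumn_nseq0 /= size_nseq.
rewrite (eq_bigr (fun=> pts q n.+1)) => [|b _].
  by rewrite sum_nat_const card_ord /=; nia.
rewrite -(IHn (d - b)); last by lia.
rewrite big_seq [RHS]big_seq; apply: eq_bigr => v /sumn_vec Hv /=.
by have -> : (sumn v == 0) = false by rewrite Hv; have := ltn_ord b; lia.
Qed.

(** Each first entry a < b contributes the full total of [sum_weight] in one variable fewer; the
    first entry b is left to induction. So K is the weight of everything below w. *)
Lemma sum_weight_lexl q n d w : d < q -> w \in vecs n.+1 d ->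
  \sum_(u <- vecs n.+1 d) lexl u w * weight q u = lexval q w.
Proof.
have [irr _ _] := lexl_order.
elim: n d w => [|n IHn] d w dq.
  rewrite mem_vecs sum_vecs1; case: w => [|b [|? ?]] //= /eqP; rewrite addn0 => ->.
  by rewrite ltnn andbF !muln0.
case: w => [|b v]; first by rewrite mem_vecs.
move=> bv; have [sv dv] : size v = n.+1 /\ b + sumn v = d.
  by move: bv; rewrite mem_vecs /= eqSS => /andP[/eqP -> /eqP ->].
rewrite sum_vecsS.
pose h a := \sum_(u <- vecs n.+1 (d - a)) lexl (a :: u) (b :: v) * weight q (a :: u).
rewrite -(big_mkord xpredT h) (@big_cat_nat _ _ _ b) //=; last by lia.
rewrite [X in _ + X]big_ltn; last by lia.
rewrite [X in _ + (_ + X)](_ : _ = 0); last first.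
  rewrite big_nat big1 // => a /andP[ba _]; rewrite /h big1 // => u _ /=.
  by rewrite ltnNge (ltnW ba) gtn_eqF.
rewrite addn0; congr (_ + _).
  rewrite (eq_big_nat _ _ (F2 := fun=> pts q n.+1)) ?sum_nat_const_nat ?subn0 ?sv //.
  move=> a /andP[_ ab]; rewrite -(@sum_weight q n (d - a)); last by lia.
  rewrite /h big_seq [RHS]big_seq; apply: eq_bigr => u /sumn_vec Hu /=.
  have -> : (sumn u == 0) = false by rewrite Hu; lia.
  by rewrite ab mul1n.
have v_vec : v \in vecs n.+1 (d - b) by rewrite mem_vecs sv eqxx; lia.
rewrite /h -(IHn (d - b)) //; last by lia.
case: (posnP (d - b)) v_vec => [->|db] v_vec.
  move: v_vec; rewrite vecs0 inE => /eqP->; rewrite !big_seq1.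
  by rewrite [lexl (nseq _ _) _]irr /lexl -/lexl ltnn eqxx irr.
rewrite big_seq [RHS]big_seq; apply: eq_bigr => u /sumn_vec Hu /=.
by rewrite ltnn eqxx /=; have -> : (sumn u == 0) = false by rewrite Hu; lia.
Qed.

Lemma weight_cat_pos q p s : 0 < sumn s -> weight q (p ++ s) = weight q s.
Proof.
move=> Hs; elim: p => //= a p ->; rewrite sumn_cat addn_eq0 [sumn s == 0]gtn_eqF //.
by rewrite andbF.
Qed.

Lemma rweightE q z u : 0 < sumn u ->
  rweight q z u = weight q (catrev u (nseq z 0)).
Proof.
elim: u z => [|[|t] u IH] z //= Hu; first by rewrite (IH z.+1).
by rewrite catrevE weight_cat_pos /= ?sumn_nseq0 ?size_nseq.
Qed.

(** * Compression along two adjacent variables *)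

Definition borel (S : pred (seq nat)) :=
  forall p a b s, S (p ++ a :: b.+1 :: s) -> S (p ++ a.+1 :: b :: s).

Lemma borel_cons S c : borel S -> borel (fun v => S (c :: v)).
Proof. by move=> bS p a b s; apply: (bS (c :: p)). Qed.

Lemma borel_rev S : borel S -> rborel (S \o rev).
Proof.
by move=> bS p a b s; rewrite /= !rev_cat !rev_cons -!cats1 -!catA; apply: bS.
Qed.

Lemma borel_dec S c v : borel S -> 0 < sumn v -> S (c :: v) -> S (c.+1 :: dec v).
Proof.
elim: v S c => [|[|b] v IH] S c bS //= Hv SH; last exact: (bS [::]).
apply: (bS [::]); apply: (IH (fun v => S (c :: v)) 0) => //; exact: borel_cons.
Qed.

Lemma divl_dec u v : divl u v -> divl (dec u) v.
Proof.
rewrite /divl; elim: u v => [|[|c] u IH] [|b v] //=; first exact: IH.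
by case/andP=> /ltnW-> ->.
Qed.

(** Units of nu are moved from the tail to the head until the head is as large as mu and the degree
    allow; the shrinking tail still divides the tail of mu. *)
Lemma borel_trunc S nu mu : borel S -> divl nu mu -> S nu -> S (trunc (sumn nu) mu).
Proof.
elim: mu S nu => [|a l IH] S [|c v] //= bS /andP[ca vl] SH.
have move_k k : k <= sumn v -> S (c + k :: iter k dec v) /\
    divl (iter k dec v) l /\ sumn (iter k dec v) = sumn v - k.
  elim: k => [|k IHk] kv; first by rewrite addn0 subn0.
  have [Hk [dk sk]] := IHk (ltnW kv).
  split; first by rewrite addnS; apply: borel_dec => //; rewrite sk subn_gt0.
  by split; [apply: divl_dec | rewrite /= sumn_dec sk; lia].
have [|Hk [dk sk]] := move_k (minn a (c + sumn v) - c); first by lia.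
move: Hk; have -> : c + (minn a (c + sumn v) - c) = minn a (c + sumn v) by lia.
move=> Hk; have := IH _ _ (@borel_cons S (minn a (c + sumn v)) bS) dk Hk.
by rewrite sk; have -> : sumn v - (minn a (c + sumn v) - c) = c + sumn v - a by lia.
Qed.

Definition above n d (S : pred (seq nat)) (mu : seq nat) :=
  has (fun nu => S nu && divl nu mu) (vecs n d).

Lemma above_borel n d e S mu : borel S -> d <= e -> mu \in vecs n e ->
  above n d S mu = S (trunc d mu).
Proof.
move=> bS de mu_vec; apply/hasP/idP => [[nu nu_vec /andP[Snu nu_mu]]|SH].
  by rewrite -(sumn_vec nu_vec); apply: borel_trunc.
exists (trunc d mu); last by rewrite SH divl_trunc.
rewrite mem_vecs size_trunc sumn_trunc (size_vec mu_vec) (sumn_vec mu_vec) eqxx.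
by rewrite (minn_idPr de) /=.
Qed.

Lemma sum_above_borel q n d e S : borel S -> d < q -> d + n * q <= e ->
  \sum_(u <- vecs n.+1 e) reduced q u * above n.+1 d S u
  = \sum_(u <- vecs n.+1 d) S u * weight q u.
Proof.
move=> bS dq de; under [RHS]eq_bigr => u _ do rewrite mulnC.
rewrite -(sum_reduced_trunc (fun u => S u : nat) dq de).
rewrite big_seq [RHS]big_seq; apply: eq_bigr => u u_vec.
by rewrite (above_borel bS _ u_vec) //; lia.
Qed.

(** * Fibres of adjacent exponents and the shift *)

Lemma sum_triangle e (H : nat -> nat -> nat) :
  \sum_(a < e.+1) \sum_(b < (e - a).+1) H a b
  = \sum_(k < e.+1) \sum_(j < k.+1) H (k - j) j.
Proof.
elim: e => [|e IH]; first by rewrite !big_ord1.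
rewrite big_ord_recr [RHS]big_ord_recr /= -IH subnn big_ord1.
rewrite [X in _ = _ + X](reindex_inj rev_ord_inj) /= [X in _ = _ + X]big_ord_recr /=.
rewrite subnn subn0 addnA -big_split /=; congr (_ + _).
apply: eq_bigr => a _; have ae := ltn_ord a.
rewrite subSn // big_ord_recr /=; congr (_ + H _ _); lia.
Qed.

(* Summing along the fibres of (x_i, x_(i+1)) |-> x_i + x_(i+1). *)
Lemma sum_vecs_fibres i r e (G G' : seq nat -> nat) :
  (forall p s k, size p = i -> size s = r -> sumn p + k + sumn s = e ->
    \sum_(j < k.+1) G (p ++ k - j :: (j : nat) :: s)
    <= \sum_(j < k.+1) G' (p ++ k - j :: (j : nat) :: s)) ->
  \sum_(u <- vecs (i + r.+2) e) G u <= \sum_(u <- vecs (i + r.+2) e) G' u.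
Proof.
elim: i e G G' => [|i IH] e G G' HG; last first.
  rewrite addSn !sum_vecsS; apply: leq_sum => c _.
  apply: (IH _ (fun v => G ((c : nat) :: v)) (fun v => G' ((c : nat) :: v))).
  move=> p s k sp ss E; apply: (HG ((c : nat) :: p)); rewrite /= ?sp //.
  by have := ltn_ord c; lia.
have split_sum (X : seq nat -> nat) : \sum_(u <- vecs r.+2 e) X u
   = \sum_(k < e.+1) \sum_(s <- vecs r (e - k)) \sum_(j < k.+1) X (k - j :: (j : nat) :: s).
  rewrite sum_vecsS.
  under eq_bigr => a _ do rewrite sum_vecsS.
  rewrite (sum_triangle e (fun a b => \sum_(s <- vecs r (e - a - b)) X (a :: b :: s))).
  apply: eq_bigr => k _; rewrite [RHS]exchange_big; apply: eq_bigr => j _ /=.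
  have jk := ltn_ord j; have ke := ltn_ord k.
  by have -> : e - (k - j) - j = e - k by lia.
rewrite add0n !split_sum; apply: leq_sum => k _.
rewrite big_seq [X in _ <= X]big_seq; apply: leq_sum => s s_vec.
apply: (HG [::]) => //; first exact: size_vec s_vec.
by rewrite (sumn_vec s_vec) /=; have := ltn_ord k; lia.
Qed.

Definition fibre_card (S : pred (seq nat)) p s k :=
  \sum_(j < k.+1) S (p ++ k - j :: (j : nat) :: s).

(** In each fibre (entries i and i + 1 of fixed sum, all others fixed) the members of S are replaced
    by equally many with the smallest entries at i + 1. *)
Definition shift i (S : pred (seq nat)) : pred (seq nat) := fun u =>
  nth 0 u i.+1 < fibre_card S (take i u) (drop i.+2 u) (nth 0 u i + nth 0 u i.+1).

Lemma nth_pair0 (p : seq nat) a b s : nth 0 (p ++ a :: b :: s) (size p) = a.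
Proof. by rewrite nth_cat ltnn subnn. Qed.

Lemma nth_pair1 (p : seq nat) a b s : nth 0 (p ++ a :: b :: s) (size p).+1 = b.
Proof. by rewrite nth_cat ltnNge leqnSn /= subSnn. Qed.

Lemma drop_pair (p : seq nat) a b s : drop (size p).+2 (p ++ a :: b :: s) = s.
Proof.
by rewrite -[a :: b :: s]/([:: a; b] ++ s) catA drop_size_cat // size_cat addn2.
Qed.

Lemma shiftE S p a b s :
  shift (size p) S (p ++ a :: b :: s) = (b < fibre_card S p s (a + b)).
Proof. by rewrite /shift take_size_cat // nth_pair0 nth_pair1 drop_pair. Qed.

Lemma fibre_card_le S p s k : fibre_card S p s k <= k.+1.
Proof. by rewrite -[X in _ <= X]card_ord -sum1_card leq_sum // => j _; case: (S _). Qed.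

Lemma sum_ltn_ord n m : \sum_(j < n) (j < m) = minn m n.
Proof.
elim: n => [|n IH]; first by rewrite big_ord0 minn0.
by rewrite big_ord_recr /= IH; lia.
Qed.

Lemma fibre_shift S p s k j : j <= k ->
  shift (size p) S (p ++ k - j :: j :: s) = (j < fibre_card S p s k).
Proof. by move=> jk; rewrite shiftE subnK. Qed.

Lemma card_shift i r d S : card_vecs (i + r.+2) d (shift i S) = card_vecs (i + r.+2) d S.
Proof.
have eq_fib p s k : size p = i ->
    \sum_(j < k.+1) shift i S (p ++ k - j :: (j : nat) :: s)
    = \sum_(j < k.+1) S (p ++ k - j :: (j : nat) :: s).
  move=> <-; rewrite -[RHS]/(fibre_card S p s k).
  rewrite -[RHS](minn_idPl (fibre_card_le S p s k)) -sum_ltn_ord.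
  by apply: eq_bigr => j _; rewrite fibre_shift // -ltnS.
apply/eqP; rewrite eqn_leq; apply/andP; split;
  by apply: (@sum_vecs_fibres i r d) => p s k sp _ _; rewrite eq_fib.
Qed.

(** * Counting multiples inside a fibre *)

Lemma count_iota_le K lo hi (P : pred nat) : (forall j, P j -> lo <= j < hi) ->
  count P (iota 0 K) <= hi - lo.
Proof.
move=> HP; rewrite -size_filter -(size_iota lo (hi - lo)).
apply: uniq_leq_size; first by rewrite filter_uniq ?iota_uniq.
by move=> j; rewrite mem_filter !mem_iota => /andP[/HP]; lia.
Qed.

Lemma count_iota_ge K (t : seq nat) (P : pred nat) : uniq t ->
  (forall j, j \in t -> j < K /\ P j) -> size t <= count P (iota 0 K).
Proof.
move=> ut HP; rewrite -size_filter; apply: uniq_leq_size => // j /HP[jK Pj].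
by rewrite mem_filter Pj mem_iota.
Qed.

Lemma sum_count_iota K (P : pred nat) : \sum_(j < K) P j = count P (iota 0 K).
Proof.
rewrite -(big_mkord xpredT (fun j => P j : nat)) /index_iota subn0.
rewrite -sum1_count [RHS]big_mkcond.
by apply: eq_bigr => j _; case: (P j).
Qed.

(** For A a set of second exponents of pairs of sum k, these are the second exponents of their
    multiples of sum k + D: (k - y, y) divides (k + D - j, j) iff y <= j <= y + D. *)
Definition spread (A : seq nat) D j := has (fun y => y <= j <= y + D) A.

Lemma spreadP A D j y : y \in A -> y <= j <= y + D -> spread A D j.
Proof. by move=> yA H; apply/hasP; exists y. Qed.

Lemma seq_min (A : seq nat) : A != [::] ->
  exists2 y, y \in A & forall x, x \in A -> y <= x.
Proof.
elim: A => // a [|b A] IH _; first by exists a => [|x]; rewrite inE // => /eqP->.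
have [//|y yA Hy] := IH; case: (leqP a y) => ay.
  exists a => [|x]; rewrite inE ?eqxx // => /orP[/eqP-> //|/Hy]; exact: leq_trans.
exists y => [|x]; rewrite inE ?yA ?orbT // => /orP[/eqP->|/Hy //]; exact: ltnW.
Qed.

Lemma seq_max (A : seq nat) : A != [::] ->
  exists2 y, y \in A & forall x, x \in A -> x <= y.
Proof.
elim: A => // a [|b A] IH _; first by exists a => [|x]; rewrite inE // => /eqP->.
have [//|y yA Hy] := IH; case: (leqP y a) => ay.
  exists a => [|x]; rewrite inE ?eqxx // => /orP[/eqP-> //|/Hy H]; exact: leq_trans ay.
exists y => [|x]; rewrite inE ?yA ?orbT // => /orP[/eqP->|/Hy //]; exact: ltnW.
Qed.

(** If some g of the window is missed, each y in A above g contributes y, and each y with y + D < g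
    contributes y + D. A further hi - k = D - lo points come from the greatest y, or from the least
    y if none exceeds g. *)
Lemma spread_interval A k D lo hi : uniq A -> {in A, forall y, y <= k} ->
  A != [::] -> lo + hi = k + D -> k <= hi ->
  count (fun j => (lo <= j <= hi) && (j < size A + D)) (iota 0 (k + D).+1) <=
  count (fun j => (lo <= j <= hi) && spread A D j) (iota 0 (k + D).+1).
Proof.
move=> uA Ak nA E khi.
case: (boolP (has (fun j => (lo <= j <= hi) && ~~ spread A D j) (iota 0 (k + D).+1))); last first.
  move=> /hasPn H; rewrite -!sum_count_iota; apply: leq_sum => j _.
  have := H j; rewrite mem_iota ltn_ord => /(_ isT).
  by case: (lo <= j <= hi) => //=; rewrite negbK => ->; case: (_ < _).
move=> /hasP[g _ /andP[/andP[log ghi] ng]].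
have gap y : y \in A -> (g < y) || (y + D < g).
  move=> yA; apply: contraNT ng; rewrite negb_or -!leqNgt => /andP[? ?].
  by apply: spreadP yA _; apply/andP.
apply: (@leq_trans (size A + (hi - k))).
  apply: leq_trans (@count_iota_le _ lo (size A + D) _ _) _ => [j|]; lia.
pose B := [seq y <- A | g < y]; pose C := [seq y + D | y <- A & y + D < g].
have sBC : size B + size C = size A.
  rewrite size_map !size_filter -(count_predC (fun y => g < y) A); congr (_ + _).
  by apply: eq_in_count => y /gap /=; lia.
have uB : uniq B by rewrite filter_uniq.
have uC : uniq C by rewrite map_inj_uniq ?filter_uniq // => x y /addIn.
have HB j : j \in B -> [/\ j \in A, g < j & j <= k].
  by rewrite mem_filter => /andP[gj jA]; split=> //; apply: Ak.
have HC j : j \in C -> exists y, [/\ y \in A, j = y + D & y + D < g].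
  by case/mapP => y; rewrite mem_filter => /andP[gy yA] ->; exists y.
case: (eqVneq B [::]) => [B0|nB].
  have [y yA ymin] := seq_min nA.
  have yg : y + D < g.
    have /orP[gy|//] := gap y yA; suff : y \in B by rewrite B0.
    by rewrite mem_filter gy yA.
  pose t := C ++ iota (y + lo) (D - lo).
  have -> : size A + (hi - k) = size t by rewrite size_cat size_iota; move: sBC; rewrite B0 /=; lia.
  apply: count_iota_ge => [|j].
    rewrite cat_uniq uC iota_uniq andbT; apply/hasPn => x; rewrite mem_iota => Hx.
    by apply/negP => /HC[z [zA zE _]]; have := ymin z zA; lia.
  rewrite mem_cat mem_iota => /orP[/HC[z [zA -> zg]]|Hj].
    split; first by lia.
    by apply/andP; split; [lia | apply: (spreadP zA); lia].
  split; first by lia.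
  by apply/andP; split; [lia | apply: (spreadP yA); lia].
have [y yB ymax] := seq_max nB.
pose t := C ++ B ++ iota y.+1 (hi - k).
have -> : size A + (hi - k) = size t by rewrite !size_cat size_iota; lia.
have [yA gy yk] := HB _ yB.
apply: count_iota_ge => [|j].
  rewrite !cat_uniq uB uC iota_uniq andbT /=; apply/andP; split; first apply/hasPn => x.
    rewrite mem_cat mem_iota => Hx; apply/negP => /HC[z [zA zE zg]].
    by case/orP: Hx => [/HB[]|]; lia.
  apply/hasPn => x; rewrite mem_iota => Hx; apply/negP => /ymax; lia.
rewrite !mem_cat mem_iota => /or3P[/HC[z [zA -> zg]]|/HB[jA gj jk]|Hj].
- split; first by lia.
  by apply/andP; split; [lia | apply: (spreadP zA); lia].
- split; first by lia.
  by apply/andP; split; [lia | apply: (spreadP jA); lia].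
- split; first by lia.
  by apply/andP; split; [lia | apply: (spreadP yA); lia].
Qed.

(** The window when nothing follows the pair: 0, or at least lo. Reached are y + D for all y in A,
    then y + lo, ..., y + D - 1 for the least y, and one more point [x0]. *)
Lemma spread_interval0 A k D lo : uniq A -> {in A, forall y, y <= k} ->
  A != [::] -> 0 < lo <= D ->
  count (fun j => ((j == 0) || (lo <= j)) && (j < size A + D)) (iota 0 (k + D).+1) <=
  count (fun j => ((j == 0) || (lo <= j)) && spread A D j) (iota 0 (k + D).+1).
Proof.
move=> uA Ak nA /andP[lo0 loD]; have [y yA ymin] := seq_min nA.
apply: (@leq_trans (size A + (D - lo).+1)).
  apply: (@leq_trans (count (pred1 0) (iota 0 (k + D).+1) +
    count (fun j => lo <= j < size A + D) (iota 0 (k + D).+1))).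
    rewrite -count_predUI; apply: leq_trans (leq_addr _ _).
    by apply: sub_count => j /=; lia.
  apply: (@leq_trans (1 + (size A + D - lo))); last by lia.
  by apply: leq_add; [rewrite count_uniq_mem ?iota_uniq // leq_b1 | apply: count_iota_le].
pose C := [seq y + D | y <- A].
have uC : uniq C by rewrite map_inj_uniq // => x z /addIn.
have HC j : j \in C -> exists z, z \in A /\ j = z + D.
  by case/mapP => z zA ->; exists z.
(* If the least y is positive, y + lo - 1 is still at least lo; otherwise 0 itself is reached. *)
pose x0 := if y == 0 then 0 else y + lo - 1.
pose t := C ++ x0 :: iota (y + lo) (D - lo).
have -> : size A + (D - lo).+1 = size t by rewrite size_cat size_map /= size_iota.
apply: count_iota_ge => [|j].
  rewrite cat_uniq uC /= iota_uniq andbT mem_iota negb_or -andbA.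
  apply/and3P; split.
  - by apply/negP => /HC[z [zA]]; have := ymin z zA; rewrite /x0; case: ifP; lia.
  - apply/hasPn => x; rewrite mem_iota => Hx.
    by apply/negP => /HC[z [zA zE]]; have := ymin z zA; lia.
  - by rewrite /x0; case: ifP; lia.
have yk := Ak y yA.
rewrite mem_cat inE mem_iota => /or3P[/HC[z [zA ->]]|/eqP->|Hj].
- have zk := Ak z zA; split; first by lia.
  by apply/andP; split; [lia | apply: (spreadP zA); lia].
- rewrite /x0; case: eqP => y0; split; try lia.
    by apply: (spreadP yA); lia.
  by apply/andP; split; [lia | apply: (spreadP yA); lia].
- split; first by lia.
  by apply/andP; split; [lia | apply: (spreadP yA); lia].
Qed.

Lemma reduced_cat q p x : reduced q (p ++ x) = reduced q (p ++ [:: sumn x]) && reduced q x.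
Proof.
elim: p => [|a p IH] /=; first by rewrite orbT.
by rewrite IH !sumn_cat /= addn0 !andbA.
Qed.

Lemma reduced_fibre q p s k : exists b, forall j, j <= k ->
  reduced q (p ++ k - j :: j :: s) =
  b && (if sumn s == 0 then (j == 0) || (k - j < q) else (k - j < q) && (j < q)).
Proof.
exists (reduced q (p ++ [:: k + sumn s]) && reduced q s) => j jk.
rewrite reduced_cat /=; have -> : k - j + (j + sumn s) = k + sumn s by lia.
rewrite -!andbA; case: (reduced q (p ++ _)) => //=.
case: (reduced q s); rewrite ?andbF // !andbT addn_eq0.
by case: (sumn s == 0); rewrite ?andbT ?andbF ?orbT ?orbF ?andbT // orbC.
Qed.

Lemma divl_cat p p' v w : size p = size p' ->
  divl (p ++ v) (p' ++ w) = divl p p' && divl v w.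
Proof.
rewrite /divl; elim: p p' => [|a p IH] [|b p'] //= [/IH->].
exact: andbA.
Qed.

Lemma seq_split_pair i (u : seq nat) : i.+1 < size u ->
  exists p a b s, size p = i /\ u = p ++ a :: b :: s.
Proof.
move=> iu; exists (take i u), (nth 0 u i), (nth 0 u i.+1), (drop i.+2 u); split.
  by rewrite size_take ltnW.
by rewrite -drop_nth // -drop_nth ?cat_take_drop // ltnW.
Qed.

(** Compare fibre by fibre. Take the multiple of the shifted set with largest second exponent jm and
    a divisor nu of it: the members of S in the fibre of nu alone already have enough multiples. *)
Lemma sum_above_shift q i r d e S : d < q ->
  \sum_(u <- vecs (i + r.+2) e) reduced q u * above (i + r.+2) d (shift i S) u <=
  \sum_(u <- vecs (i + r.+2) e) reduced q u * above (i + r.+2) d S u.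
Proof.
move=> dq; apply: sum_vecs_fibres => p s K sp ss _.
set n := i + r.+2.
pose x j := p ++ K - j :: j :: s.
case: (boolP (has (fun j => above n d (shift i S) (x j)) (iota 0 K.+1))); last first.
  move/hasPn=> H; rewrite big1 // => j _.
  by rewrite -/(x j) (negbTE (H _ _)) ?muln0 // mem_iota ltn_ord.
move/hasP=> [j1]; rewrite mem_iota => /andP[_ j1K] Hj1.
pose good j := (j <= K) && above n d (shift i S) (x j).
have ex_good : exists j, good j by exists j1; rewrite /good Hj1 andbT; lia.
have good_le j : good j -> j <= K by case/andP.
have [jm /andP[jmK /hasP[nu nu_vec /andP[Snu nu_x]]] jm_max] := ex_maxnP ex_good good_le.
have [|p' [a [b [s' [sp' nuE]]]]] := @seq_split_pair i nu.
  by rewrite (size_vec nu_vec) /n; lia.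
have ss' : size s' = r.
  by have := size_vec nu_vec; rewrite nuE size_cat sp' /= /n; lia.
have dnu : sumn p' + (a + b) + sumn s' = d.
  by rewrite -(sumn_vec nu_vec) nuE sumn_cat /=; lia.
move: nu_x; rewrite nuE /x divl_cat ?sp ?sp' // => /andP[pp /=].
rewrite /divl /= => /and3P[aK bj ss_div].
have b_lt : b < fibre_card S p' s' (a + b) by rewrite -shiftE sp' -nuE.
set k := a + b in b_lt dnu.
pose A := [seq y <- iota 0 k.+1 | S (p' ++ k - y :: y :: s')].
have sA : size A = fibre_card S p' s' k.
  by rewrite size_filter -(sum_count_iota _ (fun y => S (p' ++ k - y :: y :: s'))).
have nA : A != [::] by rewrite -size_eq0 sA; lia.
have uA : uniq A by rewrite filter_uniq ?iota_uniq.
have Ak : {in A, forall y, y <= k}.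
  by move=> y; rewrite mem_filter mem_iota => /andP[_]; lia.
pose D := K - k; have KE : K = k + D by rewrite /D /k; lia.
have spread_above j : j <= K -> spread A D j -> above n d S (x j).
  move=> jK /hasP[y]; rewrite mem_filter mem_iota => /andP[Sy yk] /andP[yj jy].
  apply/hasP; exists (p' ++ k - y :: y :: s').
    rewrite mem_vecs size_cat sp' /= ss' sumn_cat /=; apply/andP; split; apply/eqP.
      by rewrite /n.
    by lia.
  rewrite Sy /x divl_cat ?sp ?sp' // pp /divl /= yj ss_div andbT andbT.
  by rewrite KE; lia.
have [c redE] := reduced_fibre q p s K.
pose J j := c && (if sumn s == 0 then (j == 0) || (K - j < q) else (K - j < q) && (j < q)).
have kq : k < q by lia.
(* Every j counted on the left satisfies j <= jm <= b + D < size A + D. *)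
apply: (@leq_trans (count (fun j => J j && (j < size A + D)) (iota 0 K.+1))).
  rewrite -sum_count_iota; apply: leq_sum => j _; have jK : j <= K by rewrite -ltnS.
  rewrite redE // -/(J j) -/(x j); case: (J j) => //=; rewrite mul1n.
  case Uj : (above _ _ _ _) => //=; rewrite lt0b sA.
  have : j <= jm by apply: jm_max; rewrite /good jK Uj.
  by rewrite /D; lia.
apply: (@leq_trans (count (fun j => J j && spread A D j) (iota 0 K.+1))); last first.
  rewrite -sum_count_iota; apply: leq_sum => j _; have jK : j <= K by rewrite -ltnS.
  rewrite redE // -/(J j) -/(x j); case: (J j) => //=; rewrite mul1n.
  by case Hj : (spread A D j) => //=; rewrite spread_above.
rewrite /J; case: c {redE J} => /=; last by rewrite !count_pred0.
have change_J (J J' P Q : pred nat) : (forall j, j <= K -> J j = J' j) ->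
    count (fun j => J' j && P j) (iota 0 K.+1) <= count (fun j => J' j && Q j) (iota 0 K.+1) ->
    count (fun j => J j && P j) (iota 0 K.+1) <= count (fun j => J j && Q j) (iota 0 K.+1).
  by move=> JE; congr (_ <= _); apply: eq_in_count => j; rewrite mem_iota => jK; rewrite JE.
have main1 : count (fun j => ((K - j < q) && (j < q)) && (j < size A + D)) (iota 0 K.+1) <=
  count (fun j => ((K - j < q) && (j < q)) && spread A D j) (iota 0 K.+1).
  (* Both exponents below q give a window symmetric under j -> K - j, and k <= hi since k <= d <
     q. *)
  pose hi := minn K q.-1; pose lo := K - hi.
  apply: (change_J _ (fun j => lo <= j <= hi)); first by move=> j; rewrite /lo /hi; lia.
  have := @spread_interval A k D lo hi uA Ak nA; rewrite -KE; apply; rewrite /lo /hi; lia.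
case: (sumn s == 0) => //; case: (ltnP K q) => Kq.
  by apply: (change_J _ (fun j => (K - j < q) && (j < q))) => // j; lia.
apply: (change_J _ (fun j => (j == 0) || (K - q.-1 <= j))); first by move=> j; lia.
have := @spread_interval0 A k D (K - q.-1) uA Ak nA; rewrite -KE; apply.
by rewrite /D; lia.
Qed.

(** The sum of i * u_i, which drops when exponents move to earlier variables; its total over a set
    makes compression terminate. *)
Fixpoint potential (u : seq nat) : nat :=
  if u is _ :: v then potential v + sumn v else 0.

Lemma potential_fibre p s k j : j <= k ->
  potential (p ++ k - j :: j :: s) = potential (p ++ k :: 0 :: s) + j.
Proof.
move=> jk; elim: p => [|a p IH] /=; first by lia.
by rewrite IH !sumn_cat /=; lia.
Qed.

Lemma sum_initial_le k (A : pred nat) :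
  \sum_(j < \sum_(i < k) A i) j <= \sum_(j < k) A j * j.
Proof.
elim: k => [|k IH]; first by rewrite !big_ord0.
rewrite [X in _ <= X]big_ord_recr big_ord_recr /=.
case: (A k); last by rewrite mul0n !addn0.
have : \sum_(i < k) A i <= k.
  by rewrite -[X in _ <= X]card_ord -sum1_card leq_sum // => j _; case: (A _).
by move: IH; move: (\sum_(i < k) A i) => s IH sk; rewrite addn1 big_ord_recr mul1n leq_add.
Qed.

Lemma sum_initial_lt k b (A : pred nat) : b.+1 < k -> ~~ A b -> A b.+1 ->
  \sum_(j < \sum_(i < k) A i) j < \sum_(j < k) A j * j.
Proof.
elim: k => // k IH bk nAb Ab; rewrite [X in _ < X]big_ord_recr big_ord_recr /=.
case Ak: (A k); last first.
  rewrite mul0n !addn0; apply: IH => //; rewrite ltn_neqAle -ltnS bk andbT.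
  by apply: contraFneq Ak => <-.
have bk' : b < k by lia.
have : \sum_(i < k) A i < k.
  rewrite (bigD1 (Ordinal bk')) //= (negbTE nAb) add0n.
  apply: leq_ltn_trans (_ : #|predC1 (Ordinal bk')| < k); last first.
    by rewrite cardC1 card_ord; lia.
  by rewrite -sum1_card; apply: leq_sum => j _; case: (A j).
have := sum_initial_le k A.
by move: (\sum_(i < k) A i) => s IHk sk; rewrite addn1 big_ord_recr mul1n -addnS leq_add.
Qed.

Lemma sum_potential_fibre (X : pred nat) p s k :
  \sum_(j < k.+1) X j * potential (p ++ k - j :: (j : nat) :: s)
  = (\sum_(j < k.+1) X j) * potential (p ++ k :: 0 :: s) + \sum_(j < k.+1) X j * j.
Proof.
rewrite big_distrl -big_split; apply: eq_bigr => j _ /=.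
by rewrite potential_fibre ?mulnDr // -ltnS.
Qed.

Lemma sum_potential_shift_lt i r d (S : pred (seq nat)) p a b s :
  size p = i -> p ++ a :: b.+1 :: s \in vecs (i + r.+2) d ->
  S (p ++ a :: b.+1 :: s) -> ~~ S (p ++ a.+1 :: b :: s) ->
  \sum_(u <- vecs (i + r.+2) d) shift i S u * potential u <
  \sum_(u <- vecs (i + r.+2) d) S u * potential u.
Proof.
move=> sp u0_vec Su nSv; set u0 := p ++ _ in u0_vec Su.
(* Adding the indicator of u0 makes the strict inequality a weak one that can be checked fibrewise;
   only the fibre of u0 needs a strict gain. *)
have <- : \sum_(u <- vecs (i + r.+2) d) (shift i S u * potential u + (u == u0)) =
   (\sum_(u <- vecs (i + r.+2) d) shift i S u * potential u).+1.
  rewrite big_split /= -[RHS]addn1; congr (_ + _).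
  rewrite (bigD1_seq u0) ?vecs_uniq //= eqxx big1 // => u.
  by case: (u == u0).
apply: sum_vecs_fibres => p' s' k sp' _ _.
set A := fun j => S (p' ++ k - j :: j :: s').
rewrite big_split /= (sum_potential_fibre A).
have shE (j : 'I_k.+1) : shift i S (p' ++ k - j :: (j : nat) :: s') =
    (j < \sum_(i < k.+1) A i) by rewrite -sp' fibre_shift // -ltnS.
under eq_bigr => j _ do rewrite shE.
rewrite (sum_potential_fibre (fun j => j < \sum_(i < k.+1) A i)).
have le_card : \sum_(i < k.+1) A i <= k.+1 by exact: fibre_card_le.
rewrite sum_ltn_ord (minn_idPl le_card) -addnA leq_add2l.
have -> : \sum_(j < k.+1) (j < \sum_(i0 < k.+1) A i0) * j = \sum_(j < \sum_(i < k.+1) A i) j.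
  move: le_card; move: (\sum_(i < k.+1) A i) => m mk.
  rewrite (big_ord_widen _ (fun j => j) mk) [RHS]big_mkcond.
  by apply: eq_bigr => j _; case: (_ < _); rewrite ?mul1n.
case: (boolP [exists j : 'I_k.+1, p' ++ k - j :: (j : nat) :: s' == u0]); last first.
  rewrite negb_exists => /forallP H; rewrite [X in _ + X]big1 => [|j _].
    by rewrite addn0; apply: sum_initial_le.
  by rewrite (negbTE (H j)).
case/existsP=> j /eqP; rewrite /u0 => /eqP; rewrite eqseq_cat ?sp ?sp' //.
move=> /andP[/eqP Ep /eqP[Ea Eb Es]].
have jk := ltn_ord j.
have -> : \sum_(j < k.+1) (p' ++ k - j :: (j : nat) :: s' == u0) = 1.
  rewrite (bigD1 j) //= big1 => [|j' Hj'].
    by rewrite Ep Ea Eb Es eqxx.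
  apply/eqP; rewrite eqb0; apply: contra Hj'; rewrite /u0 eqseq_cat ?sp ?sp' //.
  by case/andP=> _ /eqP[_ Eb' _]; rewrite -val_eqE /= Eb Eb'.
rewrite addn1; apply: (@sum_initial_lt _ b); first by lia.
  rewrite /A Ep Es; have -> : k - b = a.+1 by lia.
  by [].
by rewrite /A Ep Es; have -> : k - b.+1 = a by lia.
Qed.

(** Shift wherever a move fails. The total potential drops, the size is kept and the count of
    multiples does not grow. *)
Lemma borel_compression q n d e (S : pred (seq nat)) : d < q ->
  exists S' : pred (seq nat), [/\ borel S', card_vecs n d S' = card_vecs n d S &
   \sum_(u <- vecs n e) reduced q u * above n d S' u <=
   \sum_(u <- vecs n e) reduced q u * above n d S u].
Proof.
move=> dq; have [N] := ubnP (\sum_(u <- vecs n d) S u * potential u).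
elim: N S => // N IH S HN.
pose bad i u := [&& i.+1 < n, S u, 0 < nth 0 u i.+1 &
  ~~ S (take i u ++ (nth 0 u i).+1 :: (nth 0 u i.+1).-1 :: drop i.+2 u)].
case: (boolP (has (fun i => has (bad i) (vecs n d)) (iota 0 n))).
  case/hasP=> i _ /hasP[u u_vec /and4P[lt_in Su pos nS]].
  have nE : i + (n - i.+2).+2 = n by lia.
  have lt_pot : \sum_(u <- vecs n d) shift i S u * potential u <
      \sum_(u <- vecs n d) S u * potential u.
    have lt_iu : i.+1 < size u by rewrite (size_vec u_vec).
    have uE : take i u ++ nth 0 u i :: (nth 0 u i.+1).-1.+1 :: drop i.+2 u = u.
      by rewrite prednK // -drop_nth // -drop_nth ?cat_take_drop // ltnW.
    have := @sum_potential_shift_lt i (n - i.+2) d S (take i u) (nth 0 u i)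
      (nth 0 u i.+1).-1 (drop i.+2 u).
    by rewrite nE uE; apply=> //; rewrite size_take ltnW.
  have [|S' [bS' cS' fS']] := IH (shift i S); first exact: leq_trans lt_pot _.
  have := card_shift i (n - i.+2) d S; have := @sum_above_shift q i (n - i.+2) d e S dq.
  rewrite nE => le_f eq_c; exists S'; split=> //; first by rewrite cS'.
  exact: leq_trans fS' le_f.
move/hasPn=> closed.
have inE' u : u \in vecs n d -> (S u && (u \in vecs n d)) = S u by move->; rewrite andbT.
(* Moves were tested only on [vecs n d], while [borel] quantifies over all lists. *)
exists (fun u => S u && (u \in vecs n d)); split.
- move=> p a b s /andP[Su u_vec]; apply/andP; split; last first.
    by move: u_vec; rewrite !mem_vecs !size_cat !sumn_cat /=; lia.
  have lt_pn : (size p).+1 < n by rewrite -(size_vec u_vec) size_cat /=; lia.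
  have := closed (size p); rewrite mem_iota /= add0n (ltnW lt_pn) => /(_ isT).
  move=> /hasPn/(_ _ u_vec); rewrite /bad lt_pn Su /=.
  by rewrite take_size_cat // nth_pair0 nth_pair1 drop_pair negbK.
- by rewrite big_seq [RHS]big_seq; apply: eq_bigr => u /inE'->.
- apply: leq_sum => u _; rewrite leq_mul2l; apply/orP; right.
  have -> // : above n d (fun u => S u && (u \in vecs n d)) u = above n d S u.
  by apply: eq_in_has => v /inE' ->.
Qed.

(** * Extremality of lexicographic segments *)

Lemma lexl_move p a b s : lexl (p ++ a :: b.+1 :: s) (p ++ a.+1 :: b :: s).
Proof. by elim: p => [|c p IH] /=; rewrite ?ltnSn // IH eqxx orbT. Qed.

Lemma sum_weight_rev q n d (X : pred (seq nat)) : 0 < d ->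
  \sum_(u <- vecs n d) X u * weight q u
  = \sum_(u <- vecs n d) (X \o rev) u * rweight q 0 u.
Proof.
move=> d0; rewrite sum_vecs_rev big_seq [RHS]big_seq; apply: eq_bigr => u u_vec /=.
by rewrite rweightE // (sumn_vec u_vec).
Qed.

Section LexFootprint.
Variables (q n d e r : nat).
Hypotheses (dq : 0 < d < q) (de : d + n * q <= e) (r_bounds : 0 < r <= 'C(n + d, n)).

Let w := nth [::] (sort (fun a b => ~~ lexl a b) (vecs n.+1 d)) r.-1.
Let L : pred (seq nat) := fun u => (u \in vecs n.+1 d) && ~~ lexl u w.

Lemma rth_vec : w \in vecs n.+1 d.
Proof. by rewrite -(mem_sort (fun a b => ~~ lexl a b)) mem_nth // size_sort size_vecs; lia. Qed.

Lemma lex_initial_card : card_vecs n.+1 d L = r.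
Proof.
rewrite -[RHS](@sum_mem_take _ (vecs n.+1 d) (sort (fun a b => ~~ lexl a b) (vecs n.+1 d))).
- apply: eq_big_seq => u u_vec.
  by rewrite (mem_take_sort lexl_order [::]) ?vecs_uniq ?size_vecs // /L u_vec.
- exact: vecs_uniq.
- by rewrite perm_sort.
- by rewrite size_vecs; lia.
Qed.

Lemma lex_initial_borel : borel L.
Proof.
have [_ tr _] := lexl_order.
move=> p a b s /andP[u_vec nlt]; apply/andP; split.
  by move: u_vec; rewrite !mem_vecs !size_cat !sumn_cat /=; lia.
by apply: contra nlt; apply: tr; apply: lexl_move.
Qed.

Lemma lex_initial_segment : rlex_segment n.+1 d (L \o rev).
Proof.
have [_ tr _] := lexl_order.
move=> u v u_vec v_vec /andP[_ nlt] uv; apply/andP; split.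
  by move: v_vec; rewrite !mem_vecs size_rev sumn_rev.
apply: contra nlt; apply: tr; rewrite lexl_rev //.
by rewrite (size_vec u_vec) (size_vec v_vec).
Qed.

Lemma sum_footprint (X : pred (seq nat)) :
  \sum_(u <- vecs n.+1 e) reduced q u * ~~ X u
  + \sum_(u <- vecs n.+1 e) reduced q u * X u = pts q n.+1.
Proof.
case/andP: dq => _ dq'; rewrite -big_split -(sum_weight n dq') /=.
have := sum_reduced_trunc (fun=> 1) dq' de.
under [X in _ = X -> _]eq_bigr => u _ do rewrite muln1.
move=> <-; apply: eq_bigr => u _; rewrite -mulnDr; congr (_ * _); by case: (X u).
Qed.

Lemma lex_weight_complement :
  \sum_(u <- vecs n.+1 d) L u * weight q u + lexval q w = pts q n.+1.
Proof.
case/andP: dq => _ dq'; rewrite -(sum_weight n dq') -(sum_weight_lexl dq' rth_vec).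
rewrite -big_split big_seq [RHS]big_seq; apply: eq_bigr => u u_vec /=.
by rewrite /L u_vec -mulnDl; case: (lexl u w); rewrite ?mul1n.
Qed.

(** Compress S to a Borel set, compare its weight with that of L, and take complements in the common
    total [pts q n.+1]. *)
Lemma footprint_le (S : pred (seq nat)) : card_vecs n.+1 d S = r ->
  \sum_(u <- vecs n.+1 e) reduced q u * ~~ above n.+1 d S u <= lexval q w.
Proof.
move=> cS; case/andP: dq => d0 dq'.
have [S' [bS' cS' fS']] := @borel_compression q n.+1 d e S dq'.
have cmp : \sum_(u <- vecs n.+1 d) L u * weight q u <=
    \sum_(u <- vecs n.+1 d) S' u * weight q u.
  have eq_card : card_vecs n.+1 d (L \o rev) = card_vecs n.+1 d (S' \o rev).
    rewrite -(sum_vecs_rev n.+1 d (fun u => L u)) -(sum_vecs_rev n.+1 d (fun u => S' u)).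
    by rewrite cS' cS lex_initial_card.
  rewrite !sum_weight_rev //.
  have := @rweight_mono q n.+1 d 0 (S' \o rev) (L \o rev) dq (borel_rev bS')
    lex_initial_segment.
  by rewrite eq_card leqnn leq_add2r; apply.
have := sum_footprint (above n.+1 d S); have := lex_weight_complement.
by move: fS'; rewrite (sum_above_borel bS' dq' de); lia.
Qed.

Lemma footprint_lex :
  \sum_(u <- vecs n.+1 e) reduced q u * ~~ above n.+1 d L u = lexval q w.
Proof.
case/andP: dq => d0 dq'.
have := sum_footprint (above n.+1 d L); have := lex_weight_complement.
by rewrite (sum_above_borel lex_initial_borel dq' de); lia.
Qed.

End LexFootprint.

(** * Exponent vectors as finite functions *)

Definition expl m e (a : mono m e) : seq nat := [seq (a i : nat) | i <- enum 'I_m.+1].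

Lemma size_expl m e (a : mono m e) : size (expl a) = m.+1.
Proof. by rewrite size_map size_enum_ord. Qed.

Lemma nth_expl m e (a : mono m e) (i : 'I_m.+1) : nth 0 (expl a) i = a i.
Proof. by rewrite (nth_map i) ?size_enum_ord ?nth_ord_enum. Qed.

Lemma sumn_expl m e (a : mono m e) : sumn (expl a) = mdegree a.
Proof. by rewrite sumnE big_map big_enum. Qed.

Lemma expl_inj m e : injective (@expl m e).
Proof.
move=> a b E; apply/ffunP => i; apply/val_inj.
by rewrite /= -!nth_expl E.
Qed.

Lemma leq_nth_sumn (u : seq nat) i : nth 0 u i <= sumn u.
Proof.
elim: u i => [|a u IH] [|i] //=; first exact: leq_addr.
exact: leq_trans (IH i) (leq_addl _ _).
Qed.

Lemma expl_surj m e u : u \in vecs m.+1 e -> exists2 a : mono m e, mdegree a = e & expl a = u.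
Proof.
move=> u_vec; pose a : mono m e := [ffun i : 'I_m.+1 => inord (nth 0 u i)].
have E : expl a = u.
  apply: (@eq_from_nth _ 0); rewrite size_expl ?(size_vec u_vec) // => i im.
  rewrite -[i]/(nat_of_ord (Ordinal im)) nth_expl ffunE inordK // ltnS.
  by rewrite -(sumn_vec u_vec) leq_nth_sumn.
by exists a; rewrite // -sumn_expl E (sumn_vec u_vec).
Qed.

Lemma perm_expl m e :
  perm_eq [seq expl a | a <- enum {: mono m e} & mdegree a == e] (vecs m.+1 e).
Proof.
apply: uniq_perm; rewrite ?vecs_uniq //.
  by rewrite (map_inj_uniq (@expl_inj m e)) filter_uniq ?enum_uniq.
move=> u; apply/mapP/idP => [[a]|u_vec].
  by rewrite mem_filter => /andP[/eqP da _] ->; rewrite mem_vecs size_expl sumn_expl da !eqxx.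
have [a da <-] := expl_surj u_vec; exists a => //.
by rewrite mem_filter da eqxx mem_enum.
Qed.

Lemma card_expl m e (P : pred (seq nat)) :
  #|[set a : mono m e | (mdegree a == e) && P (expl a)]| = \sum_(u <- vecs m.+1 e) P u.
Proof.
rewrite -(perm_big _ (perm_expl m e)) /= big_map big_filter big_enum_cond /=.
rewrite -sum1_card big_mkcond [RHS]big_mkcond; apply: eq_bigr => a _.
by rewrite inE; case: (_ == e) => //=; case: (P _).
Qed.

Lemma reducedP q u :
  reflect (forall i j, i < j -> 0 < nth 0 u j -> nth 0 u i < q) (reduced q u).
Proof.
elim: u => [|a u IH] /=; first by apply: ReflectT => i j _; rewrite nth_nil.
apply: (iffP andP) => [[Ha /IH Hu] [|i] [|j] //= ij uj|H].
- case/orP: Ha => // /eqP s0; have := leq_nth_sumn u j; rewrite s0; lia.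
- exact: Hu uj.
split; last by apply/IH => i j ij; apply: (H i.+1 j.+1).
case: (posnP (sumn u)) => [_|su]; rewrite ?orbT ?orbF //.
have [j uj] : exists j, 0 < nth 0 u j.
  elim: u su {IH H} => //= b u IH; case: (posnP b) => [->|b0 _]; last by exists 0.
  by move=> /IH[j]; exists j.+1.
exact: (H 0 j.+1).
Qed.

Lemma proj_reducedE q m e (a : mono m e) : 0 < q -> proj_reduced q a = reduced q (expl a).
Proof.
move=> q0; apply/forallP/reducedP => [H i j ij|H l].
  move=> aj; have jm : j < m.+1.
    by rewrite -(size_expl a) ltnNge; apply/negP => /(nth_default 0) E; rewrite E in aj.
  have Pj : 0 < a (Ordinal jm) by rewrite -nth_expl.
  (* The definition constrains only the entries before the last positive one, at l; this is enough
     since i < j <= l. *)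
  case: (@arg_maxnP _ (Ordinal jm) (fun l => 0 < a l) (fun l => l : nat) Pj) => l al lmax.
  have im := ltn_trans ij jm.
  have jl : j <= l := lmax _ Pj.
  have := H l; rewrite al /= => /implyP Hl.
  have /Hl/forallP/(_ (Ordinal im))/implyP : [forall j0 : 'I_m.+1, (l < j0) ==> (a j0 == 0 :> nat)].
    apply/forallP => k; apply/implyP => lk; rewrite -leqn0 leqNgt; apply/negP => ak.
    by have := lmax _ ak; lia.
  rewrite -(nth_expl a (Ordinal im)) /= => Hi; have : nth 0 (expl a) i <= q.-1 by apply: Hi; lia.
  by lia.
apply/implyP => /andP[al _]; apply/forallP => i; apply/implyP => il.
by have := H i l il; rewrite !nth_expl => /(_ al); lia.
Qed.

Lemma mdividesE m d e (nu : mono m d) (mu : mono m e) :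
  mdivides nu mu = divl (expl nu) (expl mu).
Proof.
rewrite /divl /expl; have -> : mdivides nu mu = all (fun i => nu i <= mu i) (enum 'I_m.+1).
  by apply/forallP/allP => [H i _ //|H i]; apply: H; rewrite mem_enum.
by elim: (enum _) => //= i s ->.
Qed.

Lemma lexlP u v : size u = size v ->
  reflect (exists i, [/\ i < size u, nth 0 u i < nth 0 v i &
    forall j, j < i -> nth 0 u j = nth 0 v j]) (lexl u v).
Proof.
elim: u v => [|a u IH] [|b v] //= => [_|[E]]; first by apply: ReflectF => -[i []].
apply: (iffP orP) => [[ab|/andP[/eqP-> /(IH _ E)[i [iu lt_i eq_i]]]]|[[|i] /= [iu lt_i eq_i]]].
- by exists 0.
- by exists i.+1; split=> // -[|j] //; apply: eq_i.
- by left.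
right; have /= -> := eq_i 0 isT; rewrite eqxx; apply/(IH _ E); exists i; split=> // j ji.
exact: (eq_i j.+1).
Qed.

Lemma lexltE m d (b a : mono m d) : lexlt b a = lexl (expl b) (expl a).
Proof.
have sz : size (expl b) = size (expl a) by rewrite !size_expl.
apply/existsP/(lexlP sz) => [[i /andP[lt_i /forallP eq_i]]|[i [im lt_i eq_i]]].
  exists i; rewrite size_expl !nth_expl; split=> // j ji.
  have jm : j < m.+1 by apply: ltn_trans ji _.
  have := eq_i (Ordinal jm); rewrite ji => /eqP.
  by rewrite -!nth_expl.
rewrite size_expl in im; exists (Ordinal im); rewrite -!nth_expl lt_i.
by apply/forallP => j; apply/implyP => ji; rewrite -!nth_expl eq_i.
Qed.

(** [expl] respects both orders, and by antisymmetry a sorted list is determined by its multiset of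
    entries. *)
Lemma desc_lex_monosE m d :
  [seq expl a | a <- desc_lex_monos m d] = sort (fun u v => ~~ lexl u v) (vecs m.+1 d).
Proof.
have [geT getr geas] := ge_order lexl_order.
have /(perm_sortP geT getr geas) <- := perm_expl m d.
apply/esym/homo_sort_map.
- by move=> a b /geas/expl_inj.
- by move=> b a c; apply: getr.
- by move=> a b; rewrite !lexltE.
- by move=> a b; rewrite lexltE.
Qed.

Lemma ptsE q n : pts q n.+1 = pp q n.
Proof.
elim: n => [|n IH]; first by rewrite /pp big_ord1 /= muln0.
rewrite -[LHS]/(q * pts q n.+1 + 1) IH /pp [RHS]big_ord_recl addnC; congr (_ + _).
by rewrite big_distrr; apply: eq_bigr => i _; rewrite lift0 expnS.
Qed.

Lemma lexvalE q u : lexval q u = \sum_(j < size u) nth 0 u j * pts q (size u - j.+1).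
Proof.
elim: u => [|b u IH] /=; first by rewrite big_ord0.
by rewrite big_ord_recl subSS subn0 IH.
Qed.

Lemma K_rE q r d m : 0 < r <= 'C(m + d, m) ->
  K_r q r d m = lexval q (nth [::] (sort (fun u v => ~~ lexl u v) (vecs m.+1 d)) r.-1).
Proof.
move=> r_bounds; rewrite -desc_lex_monosE (nth_map [ffun=> ord0]); last first.
  by rewrite -(size_map (@expl m d)) desc_lex_monosE size_sort size_vecs; lia.
rewrite /K_r; set a := nth _ _ _.
(* The last exponent is multiplied by [pts q 0 = 0], in accordance with the sum over j < m. *)
rewrite lexvalE size_expl big_ord_recr /= subnn muln0 addn0; apply: eq_bigr => j _.
have jm := ltn_ord j; rewrite -(nth_expl a) /=; congr (_ * _).
by rewrite -ptsE; congr pts; lia.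
Qed.

Definition expl_set m d (S : {set mono m d}) : pred (seq nat) :=
  fun u => [exists a in S, expl a == u].

Lemma expl_setE m d (S : {set mono m d}) a : expl_set S (expl a) = (a \in S).
Proof.
apply/existsP/idP => [[b /andP[bS /eqP/expl_inj <-]] //|aS].
by exists a; rewrite aS eqxx.
Qed.

Lemma card_expl_set q m d (S : {set mono m d}) : S \subset Mbar q m d ->
  card_vecs m.+1 d (expl_set S) = #|S|.
Proof.
move=> /subsetP SM; rewrite -card_expl; apply: eq_card => a; rewrite inE expl_setE.
by apply/andP/idP => [[]//|aS]; have := SM _ aS; rewrite inE => /andP[].
Qed.

Lemma card_Delta q m d e (S : {set mono m d}) : 0 < q -> S \subset Mbar q m d ->
  #|Delta q e S| =
  \sum_(u <- vecs m.+1 e) reduced q u * ~~ above m.+1 d (expl_set S) u.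
Proof.
move=> q0 /subsetP SM.
rewrite (eq_bigr (fun u => (reduced q u && ~~ above m.+1 d (expl_set S) u) : nat)); last first.
  by move=> u _; case: (reduced q u); rewrite ?mul1n.
rewrite -card_expl; apply: eq_card => a; rewrite !inE proj_reducedE //.
case: eqP => //= _; rewrite ?andbF //.
case: (reduced q _) => //=; rewrite andbT; congr negb.
apply/existsP/hasP => [[nu /andP[nuS dv]]|[u u_vec /andP[/existsP[nu /andP[nuS /eqP <-]] dv]]].
  exists (expl nu); last by rewrite expl_setE nuS -mdividesE.
  have := SM _ nuS; rewrite inE => /andP[/eqP dn _].
  by rewrite mem_vecs size_expl sumn_expl dn !eqxx.
by exists nu; rewrite nuS mdividesE.
Qed.

Lemma proj_reduced_small q m d (a : mono m d) : mdegree a = d -> d < q -> proj_reduced q a.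
Proof.
move=> da dq; rewrite proj_reducedE; last by lia.
apply/reducedP => i j _ _; apply: leq_ltn_trans (leq_nth_sumn _ _) _.
by rewrite sumn_expl da.
Qed.

(** The lex initial segment attains the bound of [footprint_le]; it is admissible because all
    monomials of degree d < q are reduced. *)
Lemma A_r_eq_K_r q r d m e : 0 < d < q -> 0 < r <= 'C(m + d, m) -> d + m * q <= e ->
  A_r q r d m e = K_r q r d m.
Proof.
move=> dq r_bounds de; have q0 : 0 < q by lia.
rewrite K_rE //; set w := nth _ _ _.
apply/eqP; rewrite eqn_leq; apply/andP; split.
  apply/bigmax_leqP => S /andP[SM /eqP cS]; rewrite card_Delta //.
  by apply: footprint_le => //; rewrite (card_expl_set SM).
pose L : pred (seq nat) := fun u => (u \in vecs m.+1 d) && ~~ lexl u w.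
pose S := [set a : mono m d | (mdegree a == d) && L (expl a)].
have SM : S \subset Mbar q m d.
  apply/subsetP => a; rewrite !inE => /andP[/eqP da _].
  by rewrite da eqxx proj_reduced_small //; lia.
have SL u : u \in vecs m.+1 d -> expl_set S u = L u.
  by move=> /expl_surj[a da <-]; rewrite expl_setE inE da eqxx.
have cS : #|S| = r by rewrite card_expl (lex_initial_card dq de r_bounds).
have <- : #|Delta q e S| = lexval q w.
  rewrite card_Delta // -(footprint_lex dq de r_bounds) -/w.
  apply: eq_bigr => u _; congr (_ * ~~ _).
  by apply: eq_in_has => v /SL ->.
by rewrite /A_r; apply: (leq_bigmax_cond S); rewrite SM cS eqxx.
Qed.

(** * The projective footprint bound *)

Section Footprint.
Import GRing.Theory Order.TTheory.
Local Open Scope ring_scope.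

Definition mnm_of m e (a : mono m e) : 'X_{1..m.+1} := [multinom (a i : nat) | i < m.+1].

Lemma mdeg_mnm_of m e (a : mono m e) : mdeg (mnm_of a) = mdegree a.
Proof. by rewrite mdegE; apply: eq_bigr => i _; rewrite mnmE. Qed.

Lemma mnm_of_surj m e (mu : 'X_{1..m.+1}) : mdeg mu = e ->
  exists a : mono m e, mnm_of a = mu.
Proof.
move=> dmu; exists [ffun i => inord (mu i)]; apply/mnmP => i.
by rewrite mnmE ffunE inordK // ltnS -dmu mdegE (bigD1 i) //= leq_addr.
Qed.

Variable F : finFieldType.
Let q := #|F|.

Lemma card_finField_gt1 : (1 < q)%N.
Proof. exact: finNzRing_gt1. Qed.

Lemma expf_card_pred (x : F) : x != 0 -> x ^+ q.-1 = 1.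
Proof.
move=> x0; apply: (mulfI x0); rewrite -exprS prednK ?expf_card ?mulr1 //.
exact: ltnW card_finField_gt1.
Qed.

Lemma expf_add_card_pred (x : F) n : (0 < n)%N -> x ^+ (n + q.-1) = x ^+ n.
Proof.
move=> n0; have [->|x0] := eqVneq x 0.
  by rewrite !expr0n addn_eq0 -!leqn0 leqNgt n0.
by rewrite exprD expf_card_pred // mulr1.
Qed.

Lemma meval_add_card_pred n (nu : 'X_{1..n}) k (v : 'I_n -> F) : (0 < nu k)%N ->
  ('X_[nu + U_(k) *+ q.-1]).@[v] = ('X_[nu]).@[v].
Proof.
move=> nuk; rewrite !mevalX; apply: eq_bigr => i _.
rewrite mnmDE mulmnE mnm1E; case: eqP => [<-|_]; last by rewrite mul0n addn0.
by rewrite mul1n expf_add_card_pred.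
Qed.

Variables (m d e r : nat).
Hypotheses (dq : (d < q)%N) (me : (m * q < e)%N).
Variable Fs : 'I_r -> {mpoly F[m.+1]}.
Hypotheses (homF : forall i, Fs i \is d.-homog) (indF : lin_indep Fs).

Let comb (c : {ffun 'I_r -> F}) := \sum_(i < r) c i *: Fs i.

Definition lead_monos : {set mono m d} :=
  [set a | [exists c, (comb c != 0) && (mlead (comb c) == mnm_of a)]].

Lemma comb_homog c : comb c \is d.-homog.
Proof. by apply: rpred_sum => i _; apply: dhomogZ. Qed.

Lemma mdeg_mlead_comb c : comb c != 0 -> mdeg (mlead (comb c)) = d.
Proof. by move=> c0; apply: (dhomog_mf (comb_homog c)); apply: mlead_supp. Qed.

(** Otherwise a nontrivial combination of the [Fs] would have zero coefficient at every monomial of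
    [lead_monos], including its own leading one. *)
Lemma card_lead_monos : (r <= #|lead_monos|)%N.
Proof.
rewrite leqNgt; apply/negP => lt_r.
pose N : 'M[F]_(r, #|lead_monos|) := \matrix_(i, j) (Fs i)@_(mnm_of (enum_val j)).
have : kermx N != 0.
  rewrite kermx_eq0 /row_free ltn_eqF //.
  exact: leq_ltn_trans (rank_leq_col N) lt_r.
case/rowV0Pn => v /sub_kermxP vN v0.
pose c : {ffun 'I_r -> F} := [ffun i => v 0 i].
have c0 : comb c != 0.
  apply: contra v0 => /eqP cz; apply/eqP/rowP => i; rewrite mxE.
  by have := indF cz i; rewrite ffunE.
have [a ha] := mnm_of_surj (mdeg_mlead_comb c0).
have a_in : a \in lead_monos.
  by rewrite inE; apply/existsP; exists c; rewrite c0 ha eqxx.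
have : (comb c)@_(mlead (comb c)) == 0.
  move/rowP: vN => /(_ (enum_rank_in a_in a)); rewrite !mxE => H.
  apply/eqP; rewrite raddf_sum -[RHS]H; apply: eq_bigr => i _ /=.
  by rewrite mcoeffZ ffunE mxE enum_rankK_in // ha.
by rewrite mleadc_eq0 (negbTE c0).
Qed.

Lemma comb_vanish c (v : {ffun 'I_m.+1 -> F}) : v \in Vpts Fs -> (comb c).@[v] = 0.
Proof.
rewrite inE => /andP[_ /forallP H]; rewrite raddf_sum big1 // => i _.
by rewrite /= mevalZ (eqP (H i)) mulr0.
Qed.

(** * Reduction of monomials and interpolation on the variety *)

Section Reduction.
Variable S : {set mono m d}.
Hypothesis S_lead : S \subset lead_monos.

Let V := Vpts Fs.
Let D := Delta q e S.
Let ev (p : {mpoly F[m.+1]}) : 'rV[F]_#|V| := \row_j p.@[(enum_val j : {ffun _ -> F})].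
Let A : 'M[F]_(#|D|, #|V|) := \matrix_i ev 'X_[mnm_of (enum_val i)].

Let evZ c p : ev (c *: p) = c *: ev p.
Proof. by apply/rowP => j; rewrite !mxE mevalZ. Qed.

Let ev_sum (s : seq 'X_{1..m.+1}) P (G : 'X_{1..m.+1} -> {mpoly F[m.+1]}) :
  ev (\sum_(k <- s | P k) G k) = \sum_(k <- s | P k) ev (G k).
Proof.
apply: (big_morph ev) => [x y|]; apply/rowP => j; rewrite !mxE ?mevalD ?meval0 //.
Qed.

(** Well-founded induction: on V, a monomial outside Delta agrees with a combination of smaller
    monomials of the same degree. *)
Lemma ev_monomial_sub mu : mdeg mu = e -> (ev 'X_[mu] <= A)%MS.
Proof.
elim/(@ltmwf m.+1): mu => mu IH dmu; have [a ha] := mnm_of_surj dmu.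
have da : mdegree a = e by rewrite -mdeg_mnm_of ha.
case: (boolP (a \in D)) => [aD|].
  have -> : ev 'X_[mu] = row (enum_rank_in aD a) A.
    by rewrite rowK enum_rankK_in // ha.
  exact: row_sub.
rewrite !inE da eqxx /=; case: (boolP (proj_reduced q a)) => [_|nred _]; last first.
  move: nred; rewrite negb_forall => /existsP[l].
  rewrite negb_imply => /andP[/andP[al _]].
  rewrite negb_forall => /existsP[i]; rewrite negb_imply -ltnNge => /andP[il ai].
  have mui : (q.-1 < mu i)%N by rewrite -ha mnmE.
  have mul : (0 < mu l)%N by rewrite -ha mnmE.
  have lneqi : (i == l) = false by apply/negbTE; rewrite -val_eqE ltn_eqF.
  pose nu := (mu - U_(i) *+ q.-1)%MM.
  have le_mu : (U_(i) *+ q.-1 <= mu)%MM.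
    apply/mnm_lepP => j; rewrite mulmnE mnm1E; case: eqP => [<-|_] //.
    by rewrite mul1n ltnW.
  have muE : (nu + U_(i) *+ q.-1)%MM = mu by rewrite submK.
  (* Exponent q - 1 passes from x_i to the later x_l. Both variables occur in nu, so values are
     unchanged, and the monomial decreases. *)
  pose mu' := (nu + U_(l) *+ q.-1)%MM.
  have dmu' : mdeg mu' = e by rewrite -dmu -muE !mdegD !mdegMn !mdeg1.
  have -> : ev 'X_[mu] = ev 'X_[mu'].
    apply/rowP => j; rewrite !mxE -{1}muE !meval_add_card_pred //.
      by rewrite mnmBE mulmnE mnm1E lneqi mul0n subn0.
    by rewrite mnmBE mulmnE mnm1E eqxx mul1n subn_gt0.
  apply: IH => //; apply/(ltmcP (etrans dmu' (esym dmu))); exists i => [j ji|].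
    rewrite mnmDE mnmBE !mulmnE !mnm1E.
    have -> : (i == j) = false by apply/negbTE; rewrite -val_eqE gtn_eqF.
    have -> : (l == j) = false.
      by apply/negbTE; rewrite -val_eqE gtn_eqF // (ltn_trans ji il).
    by rewrite !mul0n subn0 addn0.
  rewrite mnmDE mnmBE !mulmnE !mnm1E eqxx [l == i]eq_sym lneqi mul1n mul0n addn0.
  have := card_finField_gt1; lia.
rewrite negb_and negbK orbF => /existsP[nu /andP[nuS /forallP dv]].
move/subsetP: S_lead => /(_ _ nuS); rewrite inE => /existsP[c /andP[c0 /eqP lc]].
set p := comb c in c0 lc; set be := mnm_of nu in lc.
have le_be : (be <= mu)%MM by apply/mnm_lepP => i; rewrite -ha !mnmE.
have dbe : mdeg be = d by rewrite -lc mdeg_mlead_comb.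
have lc0 : p@_be != 0 by rewrite -lc mleadc_eq0.
have bes : be \in msupp p by rewrite -lc mlead_supp.
have d_diff : (mdeg (mu - be)%MM + d)%N = e by rewrite -dmu -{2}(submK le_be) mdegD dbe.
(* This multiple of p vanishes on V and has leading monomial mu, so mu can be expressed through its
   other, smaller monomials. *)
have ev0 : ev ('X_[mu - be] * p) = 0.
  apply/rowP => j; rewrite !mxE mevalM comb_vanish ?mulr0 //; exact: enum_valP.
have pE : 'X_[mu - be] * p = \sum_(k <- msupp p) p@_k *: 'X_[mu - be + k].
  rewrite {1}[p]mpolyE mulr_sumr; apply: eq_bigr => k _.
  by rewrite -scalerAr mpolyXD.
have : (p@_be *: ev 'X_[mu] <= A)%MS.
  have -> : p@_be *: ev 'X_[mu] =
      - \sum_(k <- msupp p | k != be) p@_k *: ev 'X_[mu - be + k].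
    apply/eqP; rewrite -addr_eq0 -{1}(submK le_be); apply/eqP; rewrite -[RHS]ev0 pE.
    rewrite ev_sum (bigD1_seq be) ?msupp_uniq //= evZ; congr (_ + _).
    by apply: eq_bigr => k _; rewrite evZ.
  rewrite eqmx_opp big_seq_cond; apply: summx_sub => k /andP[ks kbe].
  have dk : mdeg k = d := dhomog_mf (comb_homog c) ks.
  apply: scalemx_sub; apply: IH; last by rewrite mdegD dk.
  rewrite -{2}(submK le_be) ltmc_add2r lt_neqAle kbe /=.
  by rewrite -lc msupp_le_mlead.
by rewrite (eqmx_scale _ lc0).
Qed.

Lemma ev_homog_sub p : p \is e.-homog -> (ev p <= A)%MS.
Proof.
move=> hp; rewrite [p]mpolyE ev_sum big_seq; apply: summx_sub => k ks.
rewrite evZ; apply: scalemx_sub; apply: ev_monomial_sub.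
exact: dhomog_mf hp _ ks.
Qed.

(* The homogeneous Lagrange interpolation polynomial at P, with l the position
   of the leading 1 of P. *)
Let lagrange (P : {ffun 'I_m.+1 -> F}) (l : 'I_m.+1) : {mpoly F[m.+1]} :=
  'X_l ^+ (e - m * q.-1) *
  \prod_(i < m.+1 | i != l) ('X_l ^+ q.-1 - ('X_i - P i *: 'X_l) ^+ q.-1).

Lemma interpolation_degree : (m * q.-1 < e)%N.
Proof. by apply: leq_ltn_trans me; rewrite leq_mul2l leq_pred orbT. Qed.

Lemma lagrange_homog P l : lagrange P l \is e.-homog.
Proof.
have homX i : ('X_i : {mpoly F[m.+1]}) \is 1.-homog by rewrite dhomogX; apply/eqP; exact: mdeg1.
have eE : (1 * (e - m * q.-1) + m * q.-1)%N = e.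
  by rewrite mul1n subnK // ltnW ?interpolation_degree.
rewrite -[X in X.-homog]eE; apply: dhomogM; first exact: dhomogMn.
have -> : (m * q.-1 = \sum_(i < m.+1 | i != l) q.-1)%N.
  by rewrite sum_nat_const cardC1 card_ord.
apply: (big_rec2 (fun (p : {mpoly F[m.+1]}) k => p \is k.-homog)).
  exact: dhomog1.
move=> i k p _ hp; apply: dhomogM => //.
rewrite -[X in X.-homog]mul1n; apply: rpredB; apply: dhomogMn => //.
by apply: rpredB => //; apply: dhomogZ.
Qed.

(** A normalized v proportional to P has its first nonzero coordinate at l too. *)
Lemma normalized_eq (P v : 'I_m.+1 -> F) (l : 'I_m.+1) : normalized v ->
  P l = 1 -> (forall j : 'I_m.+1, (j < l)%N -> P j = 0) -> v l != 0 ->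
  (forall i, i != l -> v i = P i * v l) -> v l = 1.
Proof.
move=> /existsP[i /andP[/eqP vi /forallP v0]] Pl P0 vl Hv.
case: (ltngtP i l) => [il|li|/val_inj <- //].
  have := Hv i; rewrite -val_eqE ltn_eqF // P0 // mul0r vi => /(_ isT)/eqP.
  by rewrite oner_eq0.
by have := v0 l; rewrite li (negbTE vl).
Qed.

(** If v_l is nonzero, the factor at i is 1 or 0 according to whether v_i = P_i v_l, as nonzero
    elements have (q - 1)-th power 1. If v_l = 0, the leading power, of positive exponent,
    vanishes. *)
Lemma lagrange_eval (P v : {ffun 'I_m.+1 -> F}) l : normalized v ->
  P l = 1 -> (forall j : 'I_m.+1, (j < l)%N -> P j = 0) ->
  (lagrange P l).@[v] = (v == P)%:R.
Proof.
move=> nv Pl P0; rewrite /lagrange mevalM rmorphXn /= mevalXU.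
have [vl|vl] := eqVneq (v l) 0.
  rewrite vl expr0n; have -> : (e - m * q.-1 == 0)%N = false.
    by rewrite gtn_eqF // subn_gt0 interpolation_degree.
  rewrite mul0r; case: eqP => // vP.
  by move: vl; rewrite vP Pl => /eqP; rewrite oner_eq0.
have ev_fac i : ('X_l ^+ q.-1 - ('X_i - P i *: 'X_l) ^+ q.-1 : {mpoly F[m.+1]}).@[v] =
    (v i == P i * v l)%:R.
  rewrite mevalB !rmorphXn /= mevalB mevalZ !mevalXU expf_card_pred //.
  have [->|H] := eqVneq (v i) (P i * v l).
    rewrite subrr expr0n; have -> : (q.-1 == 0)%N = false.
      by have := card_finField_gt1; lia.
    by rewrite subr0.
  by rewrite expf_card_pred ?subrr // subr_eq0.
rewrite rmorph_prod /=; under eq_bigr => i _ do rewrite ev_fac.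
case: (boolP [forall i, (i != l) ==> (v i == P i * v l)]) => [/forallP H|].
  have Hv i : i != l -> v i = P i * v l by move=> il; apply/eqP; apply: (implyP (H i)).
  have vl1 := normalized_eq nv Pl P0 vl Hv.
  have -> : v = P.
    apply/ffunP => i; have [->|/Hv->] := eqVneq i l; first by rewrite vl1 Pl.
    by rewrite vl1 mulr1.
  rewrite eqxx Pl expr1n mul1r big1 // => i _.
  by rewrite mulr1 eqxx.
rewrite negb_forall => /existsP[i]; rewrite negb_imply => /andP[il nvi].
rewrite (bigD1 i) //= (negbTE nvi) mul0r mulr0.
case: eqP => // vP; move: nvi; rewrite vP Pl mulr1 eqxx //.
Qed.

(** Interpolation puts all unit vectors in the row space of [A], so its rank |V| is at most its
    number of rows |D|. *)
Lemma card_Vpts_le_Delta : (#|V| <= #|D|)%N.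
Proof.
have : (1%:M <= A)%MS.
  apply/row_subP => j; rewrite row1.
  have : enum_val j \in V by exact: enum_valP.
  rewrite inE => /andP[/existsP[l /andP[/eqP Pl /forallP P0]] _].
  have P0' (i : 'I_m.+1) : (i < l)%N -> (enum_val j : {ffun _ -> F}) i = 0.
    by move=> il; have := P0 i; rewrite il => /eqP.
  have <- : ev (lagrange (enum_val j) l) = delta_mx 0 j.
    apply/rowP => k; rewrite !mxE lagrange_eval //; last first.
      by have := enum_valP k; rewrite inE => /andP[].
    by rewrite (inj_eq enum_val_inj).
  exact/ev_homog_sub/lagrange_homog.
move/mxrankS; rewrite mxrank1 => /leq_trans; apply; exact: rank_leq_row.
Qed.

End Reduction.

Lemma card_Vpts_le_A_r : (#|Vpts Fs| <= A_r q r d m e)%N.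
Proof.
pose S := [set a in take r (enum lead_monos)].
have S_lead : S \subset lead_monos.
  by apply/subsetP => a; rewrite inE => /mem_take; rewrite mem_enum.
have cS : #|S| = r.
  rewrite cardsE; have /card_uniqP -> : uniq (take r (enum lead_monos)).
    by rewrite take_uniq ?enum_uniq.
  by rewrite size_takel // -cardE card_lead_monos.
apply: leq_trans (card_Vpts_le_Delta S_lead) _.
rewrite /A_r; apply: (leq_bigmax_cond S); rewrite cS eqxx andbT.
apply: subset_trans S_lead _; apply/subsetP => a.
rewrite !inE => /existsP[c /andP[c0 /eqP la]].
have da : mdegree a = d by rewrite -mdeg_mnm_of -la mdeg_mlead_comb.
by rewrite da eqxx proj_reduced_small.
Qed.

End Footprint.

Theorem theorem5p8 (F : finFieldType) (m d r : nat) :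
  0 < m -> 1 <= d < #|F| -> 1 <= r <= 'C(m + d, m) ->
  (exists e0 : nat, forall e : nat, e0 <= e ->
      A_r #|F| r d m e = K_r #|F| r d m) /\
  (forall Fs : 'I_r -> {mpoly F[m.+1]},
      (forall i, Fs i \is d.-homog) -> lin_indep Fs ->
      #|Vpts Fs| <= K_r #|F| r d m).
Proof.
move=> _ dq r_bounds; have [d0 dq'] := andP dq; split.
  by exists (d + m * #|F|) => e de; apply: A_r_eq_K_r.
(* Since d > 0, this degree also exceeds m q, as interpolation requires. *)
move=> Fs homF indF; rewrite -(@A_r_eq_K_r _ _ _ _ (d + m * #|F|)) //.
by apply: card_Vpts_le_A_r => //; lia.
Qed.
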